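(* Let $\Sigma^Q$ be a pseudo-rational system of order zero, given by a $d\times d$ matrix $Q$ and a $d\times m$ matrix $P$ with entries in $M(\mathbb{R}_-)$, and let $T>-l(\det(Q))$. Then $\Sigma^Q$ is $X^{Q,1}$ reachable in time $T$ if and only if it is left-coprime.
   Context: Notation: $\mathbb{R}_-=(-\infty,0]$, $\mathbb{R}_+=[0,+\infty)$; $d,m$ are positive integers; $*$ denotes convolution (products and determinants of matrices of distributions are taken with respect to convolution); $\delta_t$ is the Dirac distribution at $t$; $I_d$ is the identity matrix. $M(\mathbb{R}_-)$ is the space of distributions of order zero (Radon measures) on $\mathbb{R}$ with compact support contained in $\mathbb{R}_-$. $M_+(\mathbb{R})$ is the space of distributions of order zero (Radon measures) on $\mathbb{R}$ with support bounded on the left. For a distribution (or function) $\alpha$ on $\mathbb{R}$, $l(\alpha):=\inf \mathrm{supp}(\alpha)$. Truncation: for a function $f$ on $\mathbb{R}$, $\pi(f):=f_{|\mathbb{R}_+}$. For a distribution $\alpha\in\mathcal{D}'(\mathbb{R})$, $\pi\alpha$ is the restriction of $\alpha$ to test functions in $\mathcal{D}(\mathbb{R}_+)$, the infinitely differentiable functions on $\mathbb{R}$ with compact support contained in $\mathbb{R}_+$. These operations are applied entrywise to vectors and matrices. Function spaces: $\Omega_1:=\bigcup_{i\ge1}L^1([-i,0],\mathbb{R})$, whose elements are regarded as functions on $\mathbb{R}$ vanishing outside a compact subset of $\mathbb{R}_-$; $\Gamma_1:=L^1_{\rm loc}(\mathbb{R}_+,\mathbb{R})$, whose elements are extended by zero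 to $\mathbb{R}$ when convolved. A pseudo-rational system of order zero $\Sigma^Q$ is given by a $d\times d$ matrix $Q$ and a $d\times m$ matrix $P$ with entries in $M(\mathbb{R}_-)$ such that $Q$ has a convolution inverse over $M_+(\mathbb{R})$, i.e. there is a $d\times d$ matrix $Q^{-1}$ with entries in $M_+(\mathbb{R})$ such that $Q^{-1}*Q=Q*Q^{-1}=\delta_0I_d$. Its impulse response matrix is $A:=Q^{-1}*P$ and its input-output relation is $y=\pi(A*u)$. Set $X^{Q,1}:=\{y\in(\Gamma_1)^d \mid \pi(Q*y)=0\}$. $\Sigma^Q$ is $X^{Q,1}$ reachable in time $T>0$ if for all $y\in X^{Q,1}$ there is $u\in(\Omega_1)^m$ with support in $[-T,0]$ such that $\pi(Q^{-1}*P*u)=y$. $\Sigma^Q$ is left-coprime if there exist matrices $R$ ($d\times d$) and $S$ ($m\times d$) with entries in $M(\mathbb{R}_-)$ such that $Q*R+P*S=I_d\delta_0$. *)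

(* Defs.v *)
From HB Require Import structures.
From mathcomp Require Import all_boot all_order all_algebra all_fingroup.
From mathcomp Require Import all_classical all_reals all_analysis.

Set Implicit Arguments.
Unset Strict Implicit.
Unset Printing Implicit Defensive.

Import Order.TTheory GRing.Theory Num.Theory.
Import numFieldNormedType.Exports.
Local Open Scope classical_set_scope.
Local Open Scope ring_scope.

Section CompactlySupported.
Variable R : realType.

Definition fsupp (f : R -> R) : set R := closure [set x | f x != 0].

Definition cc_pred : {pred R -> R^o} :=
  mem [set f : R -> R^o | continuous f /\ compact (fsupp f)].

Lemma compact_fsuppW (f : R -> R) (K : set R) :
  compact K -> [set x | f x != 0] `<=` K -> compact (fsupp f).
Proof.
move=> cK fK; apply: (subclosed_compact _ cK); first exact: closed_closure.
rewrite (closure_id K).1; first exact: closure_subset.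
by apply: compact_closed cK; exact: norm_hausdorff.
Qed.

Lemma cc_submod_closed : submod_closed cc_pred.
Proof.
split=> [|a f g]; rewrite !inE /=.
  split; first by move=> x; exact: cst_continuous.
  by apply: compact_fsuppW (@compact0 _) _ => x /=; rewrite eqxx.
move=> [cf kf] [cg kg]; split.
  move=> x; apply: continuousD; last exact: cg.
  exact: (continuousM (@cst_continuous _ _ a x) (cf x)).
apply: (compact_fsuppW (compactU kf kg)) => x /= fgx.
have [f0|f0] := eqVneq (f x) 0; [right|left]; apply: subset_closure => //=.
by apply: contra fgx => /eqP g0; rewrite !fctE f0 g0 scaler0 addr0.
Qed.

HB.instance Definition _ :=
  GRing.isSubmodClosed.Build R (R -> R^o) cc_pred cc_submod_closed.

Record Cc := MkCc { cc_fun :> R -> R^o ; cc_funP : cc_fun \in cc_pred }.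

HB.instance Definition _ := [isSub for cc_fun].
HB.instance Definition _ := [Choice of Cc by <:].
HB.instance Definition _ := [SubChoice_isSubLmodule of Cc by <:].

Lemma cc_translate_subproof (s : R) (f : Cc) :
  (fun t => f (s + t)) \in cc_pred.
Proof.
have := cc_funP f; rewrite !inE => -[cf kf]; split.
  move=> x; apply: (@continuous_comp _ _ _ (fun t : R => s + t) f).
    by apply: continuousD; [exact: cst_continuous|exact: cvg_id].
  exact: cf.
have kK : compact ((fun t : R => t - s) @` fsupp f).
  apply: continuous_compact kf.
  apply: continuous_subspaceT => x.
  by apply: continuousB; [exact: cvg_id|exact: cst_continuous].
apply: compact_fsuppW kK _ => t /= ft; exists (s + t); last by rewrite addrC addKr.
exact: subset_closure.
Qed.

Definition translate (s : R) (f : Cc) : Cc := MkCc (cc_translate_subproof s f).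

End CompactlySupported.

Section Distributions.
Variable R : realType.

(* Distributions of order zero are handled as Radon measures, i.e. as
   functionals on C_c(R); [Distr] is the bare type of functionals, and
   linearity and continuity are required by [order_zero] below. *)
Definition Distr := Cc R -> R^o.

Definition order_zero (alpha : Distr) : Prop :=
  scalar alpha /\
  forall K : set R, compact K -> exists C : R,
    forall (phi : Cc R) (M : R), fsupp phi `<=` K ->
      (forall x, `|phi x| <= M) -> `|alpha phi| <= C * M.

Definition dsupp (alpha : Distr) : set R :=
  [set x | forall U : set R, open U -> U x ->
     exists2 phi : Cc R, fsupp phi `<=` U & alpha phi != 0].

(* inf supp, with the convention l(0) = +oo. *)
Definition linf (alpha : Distr) : \bar R := ereal_inf (EFin @` dsupp alpha).

Definition Mminus (alpha : Distr) : Prop :=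
  [/\ order_zero alpha, compact (dsupp alpha) & dsupp alpha `<=` `]-oo, 0]].

Definition Mplus (alpha : Distr) : Prop :=
  order_zero alpha /\ exists a : R, dsupp alpha `<=` `[a, +oo[.

Definition dirac0 : Distr := fun phi => phi 0.

(* Extension of [alpha] in M_+(R) to the continuous functions [g] whose
   support is bounded on the right: the common value of [alpha] at the [h] in
   C_c(R) that agree with [g] on [a, +oo[, for [a] far enough to the left
   (i.e. to the left of the support of [alpha]). *)
Definition pairing (alpha : Distr) (g : R -> R) : R :=
  xget 0 [set v | exists a : R, forall h : Cc R,
    (forall x, a <= x -> h x = g x) -> alpha h = v].

(* <alpha * beta, phi> = <alpha_s, <beta_t, phi (s + t)>>.  When the supports
   of alpha and beta are bounded on the left, the inner function of s is
   continuous with support bounded on the right. *)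
Definition conv (alpha beta : Distr) : Distr :=
  fun phi => pairing alpha (fun s => beta (translate s phi)).

Definition convmx (p q r : nat) (A : 'M[Distr]_(p, q)) (B : 'M[Distr]_(q, r)) :
    'M[Distr]_(p, r) :=
  \matrix_(i, k) \sum_j conv (A i j) (B j k).

Definition dirac_mx (n : nat) : 'M[Distr]_n :=
  \matrix_(i, j) (if i == j then dirac0 else 0).

(* The Leibniz formula of \det, whose products are convolutions. *)
Definition convdet (n : nat) (A : 'M[Distr]_n) : Distr :=
  \sum_(s : 'S_n) (-1) ^+ s *: \big[conv/dirac0]_(i < n) A i (s i).

Definition fdistr (f : R -> R) : Distr :=
  fun phi => Rintegral lebesgue_measure setT (fun x => f x * phi x).

Definition convfun (p q : nat) (A : 'M[Distr]_(p, q)) (f : 'I_q -> R -> R) :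
    'I_p -> Distr :=
  fun i => \sum_j conv (A i j) (fdistr (f j)).

Definition smooth (f : R -> R) : Prop :=
  forall (n : nat) (x : R), derivable (derive1n n (f : R -> R^o)) x 1.

(* D(R_+): the support is contained in the closed half-line. *)
Definition Dplus := {phi : Cc R | smooth phi /\ fsupp phi `<=` `[0, +oo[}.

Definition trunc (alpha : Distr) : Dplus -> R := fun phi => alpha (sval phi).

Definition Omega1 (u : R -> R) : Prop :=
  exists i : nat, [/\ (1 <= i)%N,
    lebesgue_measure.-integrable `[- i%:R, 0] (EFin \o u) &
    forall t, t \notin `[- i%:R, 0] -> u t = 0].

(* Gamma_1 = L^1_loc(R_+); the values on ]-oo, 0[ are irrelevant, as these
   functions are only used through [ext0]. *)
Definition Gamma1 (y : R -> R) : Prop :=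
  forall K : set R, compact K -> K `<=` `[0, +oo[ ->
    lebesgue_measure.-integrable K (EFin \o y).

Definition ext0 (y : R -> R) : R -> R := y \_ `[0, +oo[.

End Distributions.

(* The convolution inverse [psQinv] of [psQ] over M_+(R) is unique. *)
Record pseudo_rational (R : realType) (d m : nat) := PseudoRational {
  psQ : 'M[Distr R]_d ;
  psP : 'M[Distr R]_(d, m) ;
  psQinv : 'M[Distr R]_d ;
  psQ_Mminus : forall i j, Mminus (psQ i j) ;
  psP_Mminus : forall i j, Mminus (psP i j) ;
  psQinv_Mplus : forall i j, Mplus (psQinv i j) ;
  psQinvQ : convmx psQinv psQ = dirac_mx R d ;
  psQQinv : convmx psQ psQinv = dirac_mx R d
}.

Section Systems.
Variables (R : realType) (d m : nat) (Sigma : pseudo_rational R d m).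

Definition impulse_response : 'M[Distr R]_(d, m) :=
  convmx (psQinv Sigma) (psP Sigma).

Definition state_space (y : 'I_d -> R -> R) : Prop :=
  (forall i, Gamma1 (y i)) /\
  forall i, trunc (convfun (psQ Sigma) (fun j => ext0 (y j)) i) = trunc 0.

(* pi(A * u) and y are compared as distributions on D(R_+), i.e. almost
   everywhere on R_+; supports of elements of Omega_1 are those of the
   associated distributions, hence insensitive to null sets. *)
Definition reachable_in (T : R) : Prop :=
  forall y : 'I_d -> R -> R, state_space y ->
  exists u : 'I_m -> R -> R,
    [/\ forall j, Omega1 (u j),
        forall j, dsupp (fdistr (u j)) `<=` `[- T, 0] &
        forall i, trunc (convfun impulse_response u i)
                  = trunc (fdistr (ext0 (y i)))].

Definition left_coprime : Prop :=
  exists (A : 'M[Distr R]_d) (B : 'M[Distr R]_(m, d)),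
    [/\ forall i j, Mminus (A i j), forall i j, Mminus (B i j) &
        convmx (psQ Sigma) A + convmx (psP Sigma) B = dirac_mx R d].

End Systems.

(* Main.v *)
From HB Require Import structures.
From mathcomp Require Import all_boot all_order all_algebra all_fingroup.
From mathcomp Require Import all_classical all_reals all_analysis.
From mathcomp Require Import measurable_realfun ring lra.
Require Import Defs.

(* Compactly supported order-zero functionals with support bounded on the left
   form a commutative ring under convolution, in which functions are an ideal,
   and "vanishing after truncation to [0, +oo[" means support in ]-oo, 0].

   Sufficiency: if Q R + P S = 1 and y is a state, w = Q y is supported in
   ]-oo, 0] and the input S w has output y - R w, which truncates to y.  With
   q = det Q, subtracting q z from S w, for z the part of q^-1 S w on ]-oo, 0[,
   does not change the truncated output since q Q^-1 = adj Q, and leaves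
   q times a function on [0, +oo[, hence a support in [l(q), 0].

   Necessity: for every integrable w on [-1, 0] the equation
   "Q^-1 (P u - w e_j) is supported in ]-oo, 0]" has an integrable solution u on
   [-T, 0].  Allowing measures u makes the set of right-hand sides solvable with
   norm at most k weakly closed, so a gliding-hump argument bounds u uniformly
   along an approximate identity w_n, and a weak limit solves the equation with
   w = delta_0; these limits are the columns of S, and R = Q^-1 (1 - P S). *)

Set Implicit Arguments.
Unset Strict Implicit.
Unset Printing Implicit Defensive.

Import Order.TTheory GRing.Theory Num.Theory.
Import numFieldNormedType.Exports.
Local Open Scope classical_set_scope.
Local Open Scope ring_scope.

(** * A smooth step function *)

(** Truncation sees only smooth test functions supported in the closed half-line, whereas the
    convolution ring lives on all of C_c. Passing from one to the other takes a uniform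
    approximation by smooth functions with prescribed supports, hence the explicit step function and
    partitions of unity. At order zero, a support condition says that only the values of the test
    function on a closed set matter; in this form it passes easily to sums, weak limits and
    convolutions.

    In the sufficiency part, S w alone will not do because its support may extend to the left of -T;
    q is the device that controls it, being invertible with inverse det (Q^-1). That the input is a
    function comes from w = Q y being one.

    In the necessity part, the input attached to a state is neither unique nor chosen linearly, so
    no bounded solution operator is at hand. Uniformity is reached by contradiction: data near
    delta_0 that are ever more expensive to solve are scaled down and summed into one integrable
    datum that defeats every bound. *)

Section SmoothStep.
Variable R : realType.
Implicit Types (f g : R -> R) (x y : R).

(** The classical flat function exp(-1/x), weighted by powers of 1/x so that the family is stable
    under differentiation up to linear combinations. *)
Definition bump (n : nat) (x : R) : R :=
  if 0 < x then x^-1 ^+ n * expR (- x^-1) else 0.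

Lemma bump_ge0 n x : 0 <= bump n x.
Proof.
rewrite /bump; case: ifPn => // x0.
by rewrite mulr_ge0 ?expR_ge0// exprn_ge0// invr_ge0 ltW.
Qed.

(** For positive [n], raise the inequality exp(y/n) >= y/n to the power [n]. *)
Lemma powerM_expRN_le n y : 0 < y -> y ^+ n * expR (- y) <= n%:R ^+ n.
Proof.
move=> y0; case: n => [|n]; first by rewrite !expr0 mul1r expR_le1 oppr_le0 ltW.
rewrite expRN -ler_pdivlMr ?invr_gt0 ?expR_gt0// invrK.
have -> : expR y = expR (y / n.+1%:R) ^+ n.+1.
  by rewrite -expRM_natl -mulr_natl mulrC divfK// pnatr_eq0.
rewrite -exprMn lerXn2r// ?nnegrE ?(ltW y0)//.
rewrite -ler_pdivrMl ?ltr0n// mulrC.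
by apply: le_trans (expR_ge1Dx _); rewrite lerDr.
Qed.

(** Take y = 1/x and exponent [n.+2] in the previous bound. Quadratic decay at 0 settles
    differentiability at the only point where the formula changes. *)
Lemma bump_le_sqr n x : `|bump n x| <= n.+2%:R ^+ n.+2 * x ^+ 2.
Proof.
rewrite ger0_norm ?bump_ge0// /bump; case: ifPn => x0; last first.
  by rewrite mulr_ge0 ?sqr_ge0// exprn_ge0.
rewrite -ler_pdivrMr ?exprn_gt0//.
have -> : x^-1 ^+ n * expR (- x^-1) / x ^+ 2 = x^-1 ^+ n.+2 * expR (- x^-1).
  by rewrite -exprVn !exprS; ring.
by apply: powerM_expRN_le; rewrite invr_gt0.
Qed.

Lemma is_derive0_le_sqr f C :
  (forall x, `|f x| <= C * x ^+ 2) -> is_derive (0 : R) (1 : R) f 0.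
Proof.
move=> fC.
have f0 : f 0 = 0 by apply/eqP; rewrite -normr_eq0 eq_le normr_ge0 andbT (le_trans (fC _))// expr0n mulr0.
have lim : (fun h : R => h^-1 *: ((f \o shift 0) (h *: (1:R)) - f 0)) @ 0^' --> (0:R).
  apply/cvgrPdist_le => e e0.
  have C0 : 0 <= C by have := fC 1; rewrite expr1n mulr1; apply: le_trans.
  near=> h.
  have h0 : h != 0 by near: h; exact: nbhs_dnbhs_neq.
  rewrite sub0r normrN /= f0 subr0 addr0 scaler1 normrZ normfV.
  rewrite ler_pdivrMl ?normr_gt0//.
  apply: le_trans (fC _) _.
  rewrite -real_normK ?num_real// expr2 mulrA [X in X <= _]mulrC ler_wpM2l//.
  suff: `|h| <= e / (C + 1).
    rewrite ler_pdivlMr ?ltr_wpDl//; apply: le_trans.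
    by rewrite mulrDr mulr1 [C * _]mulrC lerDl.
  near: h; apply: dnbhs0_le; rewrite divr_gt0// ltr_wpDl//.
by apply: DeriveDef; [apply/cvg_ex; exists 0|exact/cvg_lim].
Unshelve. all: by end_near. Qed.

Lemma is_derive_bump n x :
  is_derive x (1 : R) (bump n) (bump n.+2 x - n%:R * bump n.+1 x).
Proof.
have [x0|x0|->] := ltgtP x 0; last first.
- have -> : bump n.+2 0 - n%:R * bump n.+1 0 = 0 :> R.
    by rewrite /bump ltxx mulr0 subr0.
  exact: is_derive0_le_sqr (bump_le_sqr n).
- rewrite {2 3}/bump x0.
  have xn : x != 0 by rewrite gt_eqF.
  apply: (@near_eq_is_derive _ _ _ (fun y => y^-1 ^+ n * expR (- y^-1))).
    by near=> y; rewrite /bump ifT//; near: y; exact: lt_nbhsr.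
  have dV : is_derive x (1 : R) (fun y : R => y^-1) (- x ^- 2).
    have := is_deriveV (v := 1) xn (is_derive_id x 1).
    by rewrite [_ *: _]mulr1.
  have dN : is_derive x (1 : R) (fun y : R => - y^-1) (x ^- 2).
    by have := is_deriveN dV; rewrite opprK.
  have dE := @is_derive1_comp _ expR (fun y => - y^-1) _ _ _ (is_derive_expR _) dN.
  have dP : is_derive x^-1 (1 : R) (fun y : R => y ^+ n) (n%:R * x^-1 ^+ n.-1).
    have -> : (fun y : R => y ^+ n) = (id : R -> R) ^+ n.
      by apply/funext => y; rewrite exprfctE.
    apply: (is_derive_eq (is_deriveX n (is_derive_id x^-1 (1 : R)))).
    by rewrite [_ *: _]mulr1.
  have dX := @is_derive1_comp _ (fun y => y ^+ n) (fun y => y^-1) _ _ _ dP dV.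
  have := is_deriveM dX dE; rewrite /GRing.scale/= -!exprVn => H.
  apply: (is_derive_eq H).
  by case: n {dX dP H} => [|n]; rewrite ?mul0r ?mulr0 /= !exprS; ring.
- rewrite /bump ltNge ltW//= mulr0 subr0.
  apply: (@near_eq_is_derive _ _ _ (cst 0)).
  by near=> y; rewrite /bump ltNge ltW//=; near: y; exact: lt_nbhsl.
Unshelve. all: by end_near. Qed.

(** [smooth] speaks of all iterated derivatives, so an induction needs a class of functions closed
    under differentiation; this syntactic one is just large enough for the step function. *)
Inductive smooth_gen : (R -> R) -> Prop :=
| sg_cst c : smooth_gen (fun=> c)
| sg_id : smooth_gen id
| sg_bump n : smooth_gen (bump n)
| sg_add f g : smooth_gen f -> smooth_gen g -> smooth_gen (fun x => f x + g x)
| sg_mul f g : smooth_gen f -> smooth_gen g -> smooth_gen (fun x => f x * g x)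
| sg_comp f g : smooth_gen f -> smooth_gen g -> smooth_gen (fun x => f (g x)).

Lemma smooth_gen_derive f : smooth_gen f ->
  exists2 df, smooth_gen df & forall x, is_derive x (1 : R) f (df x).
Proof.
elim => {f} [c||n|f g sf [df sdf fd] sg [dg sdg gd]|f g sf [df sdf fd] sg [dg sdg gd]|f g sf [df sdf fd] sg [dg sdg gd]].
- by exists (fun=> 0) => [|x]; [exact: sg_cst|exact: is_derive_cst].
- by exists (fun=> 1) => [|x]; [exact: sg_cst|exact: is_derive_id].
- exists (fun x => bump n.+2 x + (- n%:R) * bump n.+1 x) => [|x].
    apply: sg_add; first exact: sg_bump.
    by apply: sg_mul; [exact: sg_cst|exact: sg_bump].
  by rewrite mulNr; exact: is_derive_bump.
- by exists (fun x => df x + dg x) => [|x]; [exact: sg_add|exact: is_deriveD].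
- exists (fun x => f x * dg x + g x * df x) => [|x]; last exact: is_deriveM.
  by apply: sg_add; exact: sg_mul.
- exists (fun x => df (g x) * dg x) => [|x]; last exact: (@is_derive1_comp _ f g).
  by apply: sg_mul => //; exact: sg_comp.
Qed.

Lemma smooth_gen_smooth f : smooth_gen f -> smooth f.
Proof.
move=> sf; suff H n : smooth_gen (derive1n n (f : R -> R^o)).
  move=> n x; have [df _ /(_ x) dfx] := smooth_gen_derive (H n).
  exact: (@ex_derive _ _ _ _ _ _ _ dfx).
elim: n => [//|n]; rewrite derive1nS => /smooth_gen_derive[df sdf dfx].
suff -> : derive1 (derive1n n (f : R -> R^o)) = df by [].
apply/funext => x; rewrite derive1E.
by have := dfx x => dfxx; rewrite derive_val.
Qed.

Lemma smooth_gen_continuous f : smooth_gen f -> continuous f.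
Proof.
move=> /smooth_gen_derive[df _ dfx] x.
apply: differentiable_continuous; apply/derivable1_diffP.
by have dfxx := dfx x; exact: ex_derive.
Qed.

Lemma bump0_le0 x : x <= 0 -> bump 0 x = 0.
Proof. by rewrite /bump ltNge => ->. Qed.

Lemma bump0_nd : {homo bump 0 : x y / x <= y}.
Proof.
move=> x y xy; rewrite {1}/bump; case: ifPn => [x0|_]; last exact: bump_ge0.
have y0 := lt_le_trans x0 xy.
by rewrite /bump y0 !expr0 !mul1r ler_expR lerN2 lef_pV2.
Qed.

Lemma bump01_gt0 : 0 < bump 0 1.
Proof. by rewrite /bump ltr01 expr0 mul1r expR_gt0. Qed.

(** With B = [bump 0], the function B(B(1) - B(x)) equals the constant c = B(B(1)) for x <= 0 and
    vanishes for x >= 1; the step is one minus its quotient by c. Composing B with itself avoids the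
    usual quotient of two functions, for which [smooth_gen] has no clause. *)
Lemma smooth_step_exists : exists s : R -> R, [/\ smooth_gen s,
  forall x, x <= 0 -> s x = 0, forall x, 1 <= x -> s x = 1 &
  {homo s : x y / x <= y}].
Proof.
pose c := bump 0 (bump 0 1).
have c0 : 0 < c by rewrite /c {1}/bump bump01_gt0 expr0 mul1r expR_gt0.
exists (fun x => 1 + (- c^-1) * bump 0 (bump 0 1 + (- 1) * bump 0 x)); split.
- apply: sg_add; first exact: sg_cst.
  apply: sg_mul; first exact: sg_cst.
  apply: (@sg_comp (bump 0) (fun x => bump 0 1 + (- 1) * bump 0 x)); first exact: sg_bump.
  apply: sg_add; first exact: sg_cst.
  by apply: sg_mul; [exact: sg_cst|exact: sg_bump].
- move=> x x0; rewrite (bump0_le0 x0) mulr0 addr0 mulNr mulVf ?subrr//.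
  by rewrite gt_eqF.
- move=> x x1; rewrite [X in _ * X]bump0_le0 ?mulr0 ?addr0//.
  by rewrite mulN1r subr_le0 bump0_nd.
- move=> x y xy; rewrite lerD2l !mulNr lerN2 ler_pM2l ?invr_gt0//.
  by apply: bump0_nd; rewrite lerD2l lerN2 !mul1r bump0_nd.
Qed.

(* Defined through an opaque existence proof, so that unification never unfolds
   the explicit formula. *)
Definition step : R -> R := sval (cid smooth_step_exists).

Lemma step_smooth : smooth_gen step.
Proof. by have [] := svalP (cid smooth_step_exists). Qed.

Lemma step_le0 x : x <= 0 -> step x = 0.
Proof. by have [_ + _ _] := svalP (cid smooth_step_exists); exact. Qed.

Lemma step_ge1 x : 1 <= x -> step x = 1.
Proof. by have [_ _ + _] := svalP (cid smooth_step_exists); exact. Qed.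

Lemma step_nd : {homo step : x y / x <= y}.
Proof. by have [] := svalP (cid smooth_step_exists). Qed.

Lemma step_ge0 x : 0 <= step x.
Proof.
have [x0|/ltW x0] := leP x 0; first by rewrite step_le0.
by rewrite -(@step_le0 0)// step_nd.
Qed.

Lemma step_le1 x : step x <= 1.
Proof.
have [x0|/ltW x0] := leP 1 x; first by rewrite step_ge1.
by rewrite -(@step_ge1 1)// step_nd.
Qed.

End SmoothStep.

(** * Test functions *)

Section TestFunctions.
Variable R : realType.
Implicit Types (f g : R -> R) (x y : R) (phi psi : Cc R).

Definition ccfun f := continuous f /\ exists M : R, forall x, M < `|x| -> f x = 0.

Lemma ball_itv_compact (M : R) : compact [set x : R | `|x| <= M].
Proof.
have -> : [set x : R | `|x| <= M] = `[- M, M]%classic.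
  by apply/seteqP; split => x /=; rewrite in_itv/= ler_norml.
exact: segment_compact.
Qed.

Lemma ccfunP f : ccfun f -> f \in @cc_pred R.
Proof.
move=> [cf [M fM]]; rewrite inE; split => //.
apply: (compact_fsuppW (@ball_itv_compact M)) => x /= fx0.
by rewrite leNgt; apply/negP => /fM /eqP; rewrite (negbTE fx0).
Qed.

Lemma compact_itv (K : set R) : compact K ->
  exists2 M : R, 0 <= M & forall x, K x -> `|x| <= M.
Proof.
move=> /compact_bounded[M [_ MK]]; exists (`|M| + 1); first by rewrite addr_ge0.
by move=> x Kx; apply: MK => //; rewrite ltr_pwDr// ler_norm.
Qed.

Lemma cc_continuous phi : continuous (phi : R -> R).
Proof. by have := cc_funP phi; rewrite inE => -[]. Qed.

Lemma cc_supp phi : exists2 M : R, 0 <= M & forall x, M < `|x| -> phi x = 0.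
Proof.
have := cc_funP phi; rewrite inE => -[_ /compact_itv[M M0 MK]].
exists M => // x Mx; apply/eqP/negPn/negP => fx.
have := MK _ (@subset_closure _ [set x | phi x != 0] x fx).
by rewrite leNgt Mx.
Qed.

Lemma cc_ext phi psi : phi =1 psi -> phi = psi.
Proof. by move=> h; apply/val_inj/funext. Qed.

(** Total constructor: the value is the zero test function when [f] is not continuous with compact
    support, so it is only ever read through [mkccE]. *)
Definition mkcc f : Cc R := insubd (0 : Cc R) (f : R -> R^o).

Lemma mkccE f : ccfun f -> forall x, mkcc f x = f x.
Proof. by move=> /ccfunP h x; rewrite -[cc_fun _]/(\val _) /mkcc insubdK. Qed.

Lemma cc_bounded phi : exists2 B, 0 <= B & forall x, `|phi x| <= B.
Proof.
have [M M0 HM] := cc_supp phi.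
have /compact_itv[B B0 HB] : compact (phi @` [set x : R | `|x| <= M]).
  apply: continuous_compact (@ball_itv_compact M).
  by apply: continuous_subspaceT; exact: cc_continuous.
exists B => // x; have [xM|Mx] := leP `|x| M; first by apply: HB; exists x.
by rewrite HM// normr0.
Qed.

Lemma cc_unif phi e : 0 < e ->
  exists2 d, 0 < d & forall x y, `|x - y| < d -> `|phi x - phi y| <= e.
Proof.
move=> e0; have [M M0 HM] := cc_supp phi.
have /compact_near_coveringP cov := (@ball_itv_compact M).
(* Here [y] ranges over the whole line, so the covering argument also handles pairs with a single
   point in the interval; when both are outside, [phi] vanishes at both. *)
pose P (d : R) x := forall y, `|x - y| < d -> `|phi x - phi y| <= e.
have e20 : 0 < e / 2 by rewrite divr_gt0.
have nearP : \forall d \near 0^'+, [set x : R | `|x| <= M] `<=` P d.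
  apply: cov => x _.
  have /cvgrPdist_lt/(_ _ e20) := @cc_continuous phi x.
  move=> /nbhs_ballP[r /= r0 br].
  have r20 : 0 < r / 2 by rewrite divr_gt0.
  exists (ball x (r / 2), [set d | d < r / 2]) => /=.
    by split; [exact: nbhsx_ballx|exact: nbhs_right_lt].
  move=> [x' d] /= [bx dr] y xy.
  have rr : r = r / 2 + r / 2 by exact: splitr.
  have b1 : ball x r x' by apply: le_ball bx; rewrite [X in _ <= X]rr lerDl ltW.
  have b2 : ball x r y.
    rewrite [X in ball _ X]rr; apply: (@ball_triangle _ _ x') => //.
    by rewrite /ball/= (lt_trans xy).
  have := ltrD (br _ b1) (br _ b2).
  rewrite -splitr => /ltW h; apply: le_trans h.
  rewrite (_ : phi x' - phi y = - (phi x - phi x') + (phi x - phi y)); last by ring.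
  by rewrite (le_trans (ler_normD _ _))// normrN.
have [d [/= d0 Pd]] := filter_ex (filterI (nbhs_right_gt 0) nearP).
exists d => // x y xy.
have [xM|Mx] := leP `|x| M; first exact: Pd.
have [yM|My] := leP `|y| M; first by rewrite distrC; apply: Pd => //; rewrite distrC.
by rewrite !HM// subrr normr0 ltW.
Qed.

End TestFunctions.

(** * Partitions of unity *)

Section Pou.
Variable R : realType.
Implicit Types (f g : R -> R) (x y : R) (phi psi : Cc R).

(** A difference of two consecutive shifts of [step], so that sums over [k] telescope; the [k]-th
    one lives within [d] of the node d (k - N). *)
Definition hat (d N : R) (k : nat) (x : R) : R :=
  step (d^-1 * x + (N - k%:R + 1)) + (- 1) * step (d^-1 * x + (N - k%:R)).

Lemma hat_smooth d N k : smooth_gen (hat d N k).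
Proof.
have H c : smooth_gen (fun x => step (d^-1 * x + c)).
  apply: (@sg_comp _ (@step R)); first exact: step_smooth.
  apply: sg_add; last exact: sg_cst.
  by apply: sg_mul; [exact: sg_cst|exact: sg_id].
by rewrite /hat; apply: sg_add => //; apply: sg_mul => //; exact: sg_cst.
Qed.

Lemma hat_ge0 d N k x : 0 <= hat d N k x.
Proof. by rewrite /hat mulN1r subr_ge0; apply: step_nd; lra. Qed.

Lemma hat_neq0 d N k x : 0 < d -> hat d N k x != 0 -> `|x - d * (k%:R - N)| < d.
Proof.
move=> d0; apply: contraR; rewrite -leNgt => h; apply/eqP.
have : 1 <= `|d^-1 * x + (N - k%:R)|.
  have -> : d^-1 * x + (N - k%:R) = d^-1 * (x - d * (k%:R - N)).
    by field; rewrite gt_eqF.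
  by rewrite normrM gtr0_norm ?invr_gt0// ler_pdivlMl ?mulr1.
rewrite /hat [_ + (_ + 1)]addrA; set u := d^-1 * x + (N - k%:R) => hu.
have [u0|u0] := leP 0 u.
  by rewrite ger0_norm// in hu; rewrite !step_ge1 ?mulr1 ?subrr//; lra.
by rewrite ltr0_norm// in hu; rewrite !step_le0 ?mulr0 ?addr0//; lra.
Qed.

Lemma sum_hat d N n x : \sum_(k < n) hat d N k x =
  step (d^-1 * x + (N + 1)) - step (d^-1 * x + (N + 1) - n%:R).
Proof.
elim: n => [|n IH]; first by rewrite big_ord0 subr0 subrr.
rewrite big_ord_recr /= IH /hat mulN1r.
have -> : d^-1 * x + (N - n%:R + 1) = d^-1 * x + (N + 1) - n%:R by ring.
have -> : d^-1 * x + (N + 1) - n.+1%:R = d^-1 * x + (N - n%:R) by rewrite -natr1; ring.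
by rewrite addrA subrK.
Qed.

Lemma pou (d M : R) : 0 < d -> 0 <= M ->
  exists n (h : nat -> Cc R) (s : nat -> R), [/\ forall k, smooth_gen (h k),
    forall k x, 0 <= h k x, forall x, `|x| <= M -> \sum_(k < n) h k x = 1,
    forall x, \sum_(k < n) h k x <= 1 &
    forall k x, h k x != 0 -> `|x - s k| < d /\ ((k < n)%N -> `|x| <= M + 2 * d)].
Proof.
(* This gives M < d N <= M + d: the 2 N + 1 nodes from - d N to d N cover [-M, M], and hats of
   radius [d] around them stay within M + 2 d. *)
move=> d0 M0; pose N := (Num.trunc (M / d)).+1.
have Md0 : 0 <= M / d by rewrite divr_ge0// ltW.
have /andP[N1 N2] := truncn_itv Md0.
have hcc k : ccfun (hat d N%:R k).
  split; first exact/smooth_gen_continuous/hat_smooth.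
  exists (`|d * (k%:R - N%:R)| + d) => x; apply: contraTeq => /(hat_neq0 d0) h.
  rewrite -leNgt -[x in `|x|](subrK (d * (k%:R - N%:R))) (le_trans (ler_normD _ _))//.
  by rewrite addrC lerD2l ltW.
exists (N.*2.+1), (fun k => mkcc (hat d N%:R k)), (fun k => d * (k%:R - N%:R)).
have N12 : (N%:R : R) = (Num.trunc (M / d))%:R + 1 by rewrite natr1.
split.
- move=> k; have -> : (mkcc (hat d N%:R k) : R -> R) = hat d N%:R k.
    by apply/funext; exact: mkccE.
  exact: hat_smooth.
- by move=> k x; rewrite mkccE// hat_ge0.
- move=> x xM; under eq_bigr do rewrite mkccE//.
  rewrite sum_hat -addnn -natr1 natrD.
  have : `|d^-1 * x| <= M / d.
    by rewrite normrM gtr0_norm ?invr_gt0// mulrC ler_pM2r ?invr_gt0.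
  rewrite ler_norml => /andP[h1 h2].
  by rewrite step_ge1 ?step_le0 ?subr0//; lra.
- move=> x; under eq_bigr do rewrite mkccE//.
  by rewrite sum_hat lerBlDr (le_trans (step_le1 _))// lerDl step_ge0.
- move=> k x; rewrite mkccE// => /(hat_neq0 d0) h; split => // kn.
  rewrite -[x in `|x|](subrK (d * (k%:R - N%:R))) (le_trans (ler_normD _ _))//.
  have -> : M + 2 * d = d + (M + d) by ring.
  apply: lerD; first exact: ltW.
  rewrite normrM (gtr0_norm d0).
  have kN : `|k%:R - N%:R| <= N%:R :> R.
    rewrite ler_distl subrr ler0n /= -natrD ler_nat addnn.
    by rewrite -ltnS.
  apply: le_trans (ler_wpM2l (ltW d0) kN) _.
  by rewrite N12 mulrDr mulr1 lerD2r mulrC -ler_pdivlMr.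
Qed.

End Pou.

(** * Functionals of order zero *)

Section OrderZero.
Variable R : realType.
Implicit Types (f g : R -> R) (x y : R) (phi psi : Cc R) (al be : Distr R).

Lemma fsupp_sub (F : set R) phi :
  closed F -> (forall x, ~ F x -> phi x = 0) -> fsupp phi `<=` F.
Proof.
move=> cF h; rewrite /fsupp {1}(closure_id F).1//; apply: closure_subset => x /= fx.
by apply: contrapT => /h /eqP; rewrite (negbTE fx).
Qed.

Lemma fsuppN phi x : ~ fsupp phi x -> phi x = 0.
Proof.
move=> h; apply/eqP/negPn/negP => fx; apply: h.
exact: subset_closure.
Qed.

Lemma ccD phi psi x : cc_fun (phi + psi) x = phi x + psi x. Proof. by []. Qed.
Lemma ccB phi psi x : cc_fun (phi - psi) x = phi x - psi x. Proof. by []. Qed.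
Lemma ccZ a phi x : cc_fun (a *: phi) x = a * phi x. Proof. by []. Qed.
Lemma cc0 x : cc_fun (0 : Cc R) x = 0. Proof. by []. Qed.
Lemma cc_sum n (h : 'I_n -> Cc R) x : cc_fun (\sum_(k < n) h k) x = \sum_(k < n) h k x.
Proof. exact: (big_morph (fun p : Cc R => p x) (fun p q => ccD p q x) (cc0 x)). Qed.

Section Linear.
Variable al : Distr R.
Hypothesis oz : order_zero al.

Lemma ozP a phi psi : al (a *: phi + psi) = a * al phi + al psi.
Proof. exact: oz.1. Qed.

Lemma oz0 : al 0 = 0.
Proof. by have := ozP (-1) 0 0; rewrite scaleN1r addrC subrr mulN1r addrC subrr. Qed.

Lemma ozZ a phi : al (a *: phi) = a * al phi.
Proof. by rewrite -[a *: phi]addr0 ozP oz0 addr0. Qed.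

Lemma ozD phi psi : al (phi + psi) = al phi + al psi.
Proof. by rewrite -[phi]scale1r ozP mul1r scale1r. Qed.

Lemma ozB phi psi : al (phi - psi) = al phi - al psi.
Proof. by rewrite ozD -scaleN1r ozZ mulN1r. Qed.

Lemma oz_sum n (h : 'I_n -> Cc R) : al (\sum_(k < n) h k) = \sum_(k < n) al (h k).
Proof. exact: (big_morph al ozD oz0). Qed.

Lemma oz_bound (M : R) : exists2 C : R, 0 <= C & forall phi B,
  (forall x, M < `|x| -> phi x = 0) -> (forall x, `|phi x| <= B) ->
  `|al phi| <= C * B.
Proof.
have [C HC] := oz.2 _ (@ball_itv_compact R M).
exists `|C| => // phi B hM hB.
have B0 : 0 <= B := le_trans (normr_ge0 _) (hB 0).
apply: le_trans (HC phi B _ hB) _; last by rewrite ler_wpM2r// ler_norm.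
apply: fsupp_sub => [|x /= /negP]; last by rewrite -ltNge; exact: hM.
by apply: compact_closed (@ball_itv_compact R M); exact: norm_hausdorff.
Qed.

End Linear.

Lemma order_zeroP al : (forall a phi psi, al (a *: phi + psi) = a * al phi + al psi) ->
  (forall M : R, 0 <= M -> exists C : R, forall phi B,
    (forall x, M < `|x| -> phi x = 0) -> (forall x, `|phi x| <= B) ->
    `|al phi| <= C * B) -> order_zero al.
Proof.
move=> hl hb; split=> [//|K /compact_itv[M M0 KM]].
have [C HC] := hb M M0; exists C => phi B hK hB; apply: HC => // x Mx.
by apply: fsuppN => /hK/KM; rewrite leNgt Mx.
Qed.

(** The working form of a support condition: test functions need only vanish on [F] itself, not near
    it. For closed [F] and order zero it is equivalent to an inclusion of [dsupp]. At higher order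
    it would be stronger: the derivative of a Dirac mass is supported at a point but sees more than
    the value there. *)
Definition conc al (F : set R) := forall phi, (forall x, F x -> phi x = 0) -> al phi = 0.

Lemma dsupp_conc al F : closed F -> conc al F -> dsupp al `<=` F.
Proof.
move=> cF h x dx; apply: contrapT => Fx.
have [phi hphi /eqP] := dx _ (closed_openC cF) Fx; apply; apply: h => y Fy.
by apply: fsuppN => /hphi; exact.
Qed.

(** The shrinkage map sending t to sign(t) max(|t| - e, 0). *)
Definition soft (e t : R) := Num.max (t - e) 0 + Num.min (t + e) 0.

Lemma soft_le e t : 0 <= e -> `|t - soft e t| <= e.
Proof.
move=> e0; rewrite /soft ler_norml.
have [?|?] := leP (t - e) 0; have [?|?] := leP (t + e) 0; apply/andP; split; lra.
Qed.

Lemma soft0 e t : 0 <= e -> `|t| < e -> soft e t = 0.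
Proof.
move=> e0; rewrite ltr_norml => /andP[h1 h2]; rewrite /soft.
by have [?|?] := leP (t - e) 0; have [?|?] := leP (t + e) 0; lra.
Qed.

Lemma soft_cont e f : continuous f -> continuous (soft e \o f).
Proof.
move=> cf x; rewrite /soft /comp.
apply: (@continuousD _ _ _ (fun x => Num.max (f x - e) 0) (fun x => Num.min (f x + e) 0)).
  apply: (@continuous_max _ _ (fun x => f x - e) (fun=> 0)); last exact: cvg_cst.
  by apply: continuousB; [exact: cf|exact: cvg_cst].
apply: (@continuous_min _ _ (fun x => f x + e) (fun=> 0)); last exact: cvg_cst.
by apply: continuousD; [exact: cf|exact: cvg_cst].
Qed.

Lemma norm_le_small (a C : R) : 0 <= C -> (forall e, 0 < e -> `|a| <= C * e) -> a = 0.
Proof.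
move=> C0 h; apply/eqP; rewrite -normr_le0; apply/ler_addgt0Pr => e e0; rewrite add0r.
have C1 : 0 < C + 1 by lra.
apply: le_trans (h _ (divr_gt0 e0 C1)) _.
by rewrite mulrCA ler_piMr ?(ltW e0)// ler_pdivrMr// mul1r; lra.
Qed.

End OrderZero.

(** * Supports, concentration and truncation *)

Section Supports.
Variable R : realType.
Implicit Types (f g : R -> R) (x y : R) (phi psi : Cc R) (al be : Distr R).

(** Pointwise error of a Riemann sum: [v] is the value of a function at a point, [c k] its value
    near the [k]-th node. Where [v] is nonzero the weights sum to one, so [v] is its own average,
    and only nodes with nonzero weight contribute to the error. *)
Lemma pou_approx n (h c : nat -> R) (v e : R) : 0 <= e ->
  (forall k, 0 <= h k) -> \sum_(k < n) h k <= 1 ->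
  (v != 0 -> \sum_(k < n) h k = 1) ->
  (forall k, h k != 0 -> `|v - c k| <= e) ->
  `|v - \sum_(k < n) c k * h k| <= e.
Proof.
move=> e0 h0 h1 hv hc.
have -> : v = \sum_(k < n) v * h k.
  have [->|/hv hs] := eqVneq v 0; last by rewrite -mulr_sumr hs mulr1.
  by rewrite big1// => k _; rewrite mul0r.
rewrite -sumrB; apply: le_trans (ler_norm_sum _ _ _) _.
apply: (@le_trans _ _ (\sum_(k < n) e * h k)); last first.
  by rewrite -mulr_sumr ler_piMr.
apply: ler_sum => k _; rewrite -mulrBl normrM (ger0_norm (h0 _)).
have [->|hk] := eqVneq (h k) 0; first by rewrite !mulr0.
by rewrite ler_wpM2r// hc.
Qed.

Lemma cc_mul_ccfun phi f : continuous f -> ccfun (fun x => f x * phi x).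
Proof.
move=> cf; split; first by move=> x; apply: continuousM; [exact: cf|exact: cc_continuous].
by have [M _ HM] := cc_supp phi; exists M => x /HM ->; rewrite mulr0.
Qed.

(* Soft thresholding moves the support of the test function away from that of
   [al], which allows a partition of unity subordinate to a Lebesgue number. *)
Lemma conc_dsupp al F : order_zero al -> dsupp al `<=` F -> conc al F.
Proof.
move=> oz hF phi hphi.
have [M M0 HM] := cc_supp phi.
have [C C0 HC] := oz_bound oz M.
apply: (norm_le_small C0) => e e0.
have e0' := ltW e0.
have scc : ccfun (soft e \o phi).
  split; first exact: soft_cont (@cc_continuous _ phi).
  by exists M => x /HM h; rewrite /= h soft0 ?normr0.
set psi := mkcc (soft e \o phi).
have psiE x : psi x = soft e (phi x) by rewrite mkccE.
suff psi0 : al psi = 0.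
  rewrite -[al phi]subr0 -psi0 -(ozB oz); apply: HC => x.
    by move=> /HM h; rewrite ccB psiE h soft0 ?subr0// normr0.
  by rewrite ccB psiE soft_le.
pose P (d : R) x := e <= `|phi x| -> forall chi : Cc R,
  (forall y, chi y != 0 -> `|x - y| < d) -> al chi = 0.
have nearP : \forall d \near 0^'+, [set x : R | `|x| <= M] `<=` P d.
  have /compact_near_coveringP cov := @ball_itv_compact R M.
  apply: cov => x _.
  (* If |phi x| < e, this persists nearby and the premise of [P] fails there; otherwise phi x is
     nonzero, so x is outside [F], hence outside the support. *)
  have [phie|ephi] := ltP `|phi x| e.
    have /cvgrPdist_lt := @cc_continuous _ phi x.
    move=> /(_ (e - `|phi x|)); rewrite subr_gt0 => /(_ phie) nx.
    exists ([set x' | `|phi x - phi x'| < e - `|phi x| ], setT) => /=.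
      by split; [exact: nx|exact: filterT].
    move=> [x' d] /= [h _]; rewrite /P leNgt; case/negP.
    rewrite -(subrK (phi x) (phi x')) (le_lt_trans (ler_normD _ _))// distrC.
    by rewrite -ltrBrDr.
  have Fx : ~ dsupp al x.
    by move=> /hF/hphi phi0; move: ephi; rewrite phi0 normr0 leNgt e0.
  have [U [oU Ux HU]] : exists U : set R, [/\ open U, U x &
      forall chi : Cc R, fsupp chi `<=` U -> al chi = 0].
    apply: contrapT => h; apply: Fx => U oU Ux; apply: contrapT => h'.
    apply: h; exists U; split => // chi hchi; apply/eqP/negPn/negP => ac.
    by apply: h'; exists chi.
  have /nbhs_ballP[r /= r0 br] := open_nbhs_nbhs (conj oU Ux).
  have r40 : 0 < r / 4 by lra.
  exists (ball x (r / 4), [set d | d < r / 4]) => /=.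
    by split; [exact: nbhsx_ballx|exact: nbhs_right_lt].
  move=> [x' d] /= [bx dr] _ chi hchi; apply: HU.
  apply: (@subset_trans _ (closed_ball x (r / 2))).
    apply: fsupp_sub => [|y hy]; first exact: closed_ball_closed.
    apply/eqP/negPn/negP => /hchi hxy; apply: hy.
    rewrite closed_ballE ?divr_gt0// /closed_ball_ /=.
    rewrite -(subrK x' x) -addrA (le_trans (ler_normD _ _))//.
    have : `|x - x'| < r / 4 by [].
    by lra.
  apply: subset_trans br => y; rewrite closed_ballE ?divr_gt0// /closed_ball_ /ball/=.
  by move=> /le_lt_trans; apply; lra.
have [d [/= d0 Pd]] := filter_ex (filterI (nbhs_right_gt 0) nearP).
have d20 : 0 < d / 2 by rewrite divr_gt0.
have [n [h [s [_ h0 h1 _ hs]]]] := pou d20 M0.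
have hpcc k : ccfun (fun x => h k x * psi x) by apply: cc_mul_ccfun; exact: cc_continuous.
have -> : psi = \sum_(k < n) mkcc (fun x => h k x * psi x).
  apply: cc_ext => x; rewrite cc_sum.
  under eq_bigr do rewrite mkccE//.
  rewrite -mulr_suml; have [xM|Mx] := leP `|x| M; first by rewrite h1// mul1r.
  by rewrite psiE HM// soft0 ?normr0// mulr0.
rewrite (oz_sum oz) big1// => k _.
have [[x hx]|nx] := pselect (exists x, h k x * psi x != 0); last first.
  rewrite (_ : mkcc _ = 0) ?(oz0 oz)//; apply: cc_ext => x; rewrite mkccE//.
  by apply/eqP/negPn/negP => hx; apply: nx; exists x.
have [hkx px] : h k x != 0 /\ psi x != 0 by apply/andP; rewrite -negb_or -mulf_eq0.
have xM : `|x| <= M by rewrite leNgt; apply: contra px => /HM h'; rewrite psiE h' soft0 ?normr0.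
apply: (Pd x xM) => [|y].
  by rewrite leNgt; apply: contra px => h'; rewrite psiE soft0.
rewrite mkccE// mulf_eq0 negb_or => /andP[/hs[hy _] _].
have [hx' _] := hs _ _ hkx.
rewrite -(subrK (s k) x) -addrA (le_lt_trans (ler_normD _ _))// (distrC (s k)).
by lra.
Qed.

Lemma concI al F G : order_zero al -> closed F -> closed G ->
  conc al F -> conc al G -> conc al (F `&` G).
Proof.
move=> oz cF cG aF aG; apply: conc_dsupp => // x dx.
by split; [exact: dsupp_conc aF _ dx|exact: dsupp_conc aG _ dx].
Qed.

Lemma conc_sub al (F G : set R) : F `<=` G -> conc al F -> conc al G.
Proof. by move=> FG h phi hphi; apply: h => x /FG/hphi. Qed.

(** The boundary point is the only issue: a test function supported in the closed half-line vanishes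
    at 0 as well, by continuity from the left. *)
Lemma conc_trunc al : conc al `]-oo, 0] -> trunc al = trunc (0 : Distr R).
Proof.
move=> h; apply/funext => -[phi [sphi hphi]]; rewrite /trunc/=; apply: h => x /=.
rewrite in_itv/= => x0.
have [->|xn0] := eqVneq x 0; last first.
  apply: fsuppN => /hphi/=; rewrite in_itv/= andbT => x0'.
  by move: xn0; rewrite eq_le x0 x0'.
apply/eqP/negPn/negP => phi0.
have /cvgrPdist_lt := @cc_continuous _ phi 0.
have p0 : 0 < `|phi 0| by rewrite normr_gt0.
move=> /(_ _ p0) /nbhs_ballP[r /= r0 br].
have r20 : 0 < r / 2 by rewrite divr_gt0.
have : ball 0 r (- (r / 2)).
  by rewrite /ball/= sub0r opprK gtr0_norm//; lra.
move=> /br/=; rewrite (@fsuppN _ _ (- (r / 2))) ?subr0 ?ltxx//.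
by move=> /hphi/=; rewrite in_itv/= andbT; lra.
Qed.

(** A continuous function vanishing on ]-oo, 0] is a uniform limit of smooth ones supported in [0,
    +oo[, namely of Riemann sums along a smooth partition of unity; order zero carries the uniform
    limit through [al]. *)
Lemma trunc_conc al : order_zero al -> trunc al = trunc (0 : Distr R) ->
  conc al `]-oo, 0].
Proof.
move=> oz ht phi hphi.
have [M M0 HM] := cc_supp phi.
have [C C0 HC] := oz_bound oz (M + 1).
apply: (norm_le_small C0) => e e0.
have [d' d'0 Hd'] := cc_unif phi e0.
pose d := Num.min d' 1.
have d0 : 0 < d by rewrite lt_min d'0 ltr01.
have Hd x y : `|x - y| < d -> `|phi x - phi y| <= e.
  by move=> xy; apply: Hd'; apply: lt_le_trans xy _; rewrite ge_min lexx.
have d1 : d <= 1 by rewrite ge_min lexx orbT.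
have d20 : 0 < d / 2 by rewrite divr_gt0.
have [n [h [s [sh h0 h1 h1' hs]]]] := pou d20 M0.
(* Sampling half a mesh to the left of the node kills every hat that reaches into ]-oo, 0[: its node
   is less than [d / 2], where the sample is zero. The sampling point remains within [d] of the
   support of the hat. *)
pose c k := phi (s k - d / 2).
pose psi : Cc R := \sum_(k < n) c k *: h k.
have psiE x : psi x = \sum_(k < n) c k * h k x by rewrite cc_sum.
suff psi0 : al psi = 0.
  rewrite -[al phi]subr0 -psi0 -(ozB oz); apply: HC => x.
    move=> Mx; rewrite ccB HM; last by lra.
    rewrite psiE big1 ?subr0// => k _; have [->|/hs[_]] := eqVneq (h k x) 0.
      by rewrite mulr0.
    by rewrite ltn_ord => /(_ isT); lra.
  rewrite ccB psiE; apply: (@pou_approx _ (fun k => h k x)) => //; first exact: ltW.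
    by move=> px; apply: h1; rewrite leNgt; apply: contra px => /HM ->.
  move=> k /hs[hk _]; apply: Hd; rewrite opprB addrA (addrAC x).
  rewrite (le_lt_trans (ler_normD _ _))//.
  by rewrite (gtr0_norm d20); lra.
have spsi : smooth psi.
  apply: smooth_gen_smooth; have -> : (psi : R -> R) = fun x => \sum_(k < n) c k * h k x.
    by apply/funext.
  elim: (n) => [|m IH].
    rewrite (_ : (fun x => _) = fun=> 0); first exact: sg_cst.
    by apply/funext => x; rewrite big_ord0.
  rewrite (_ : (fun x => _) = fun x => (\sum_(k < m) c k * h k x) + c m * h m x).
    by apply: sg_add => //; apply: sg_mul => //; exact: sg_cst.
  by apply/funext => x; rewrite big_ord_recr.
have fpsi : fsupp psi `<=` `[0, +oo[.
  apply: fsupp_sub => [|x /= /negP]; first exact: rray_closed.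
  rewrite in_itv/= andbT -ltNge => x0; rewrite psiE big1// => k _.
  have [->|/hs[+ _]] := eqVneq (h k x) 0; first by rewrite mulr0.
  rewrite ltr_norml => /andP[h2 h3].
  by rewrite /c hphi ?mul0r//= in_itv/=; lra.
by have := congr1 (fun t => t (exist _ psi (conj spsi fpsi))) ht.
Qed.

End Supports.

(** * Convolution *)

Section Convolution.
Variable R : realType.
Implicit Types (f g : R -> R) (x y s t a b : R) (phi psi : Cc R) (al be ga : Distr R).

(* Riemann sums along a partition of unity turn the double functional into a
   finite sum, up to an error controlled by the two order-zero bounds. *)
Lemma order_zero_fubini al be (F G : R -> Cc R) (f g : Cc R) (M : R) :
  order_zero al -> order_zero be -> 0 <= M ->
  (forall s t, F s t = G t s) -> (forall s t, M < `|s| -> F s t = 0) ->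
  (forall s t, M < `|t| -> F s t = 0) ->
  (forall e, 0 < e -> exists2 d, 0 < d &
     forall s s' t, `|s - s'| < d -> `|F s t - F s' t| <= e) ->
  (forall s, f s = be (F s)) -> (forall t, g t = al (G t)) -> al f = be g.
Proof.
move=> oa ob M0 FG Fs Ft Fu hf hg.
have [A A0 HA] := oz_bound oa (M + 1); have [B B0 HB] := oz_bound ob M.
apply/eqP; rewrite -subr_eq0; apply/eqP.
have AB0 : 0 <= 2 * (A * B) by rewrite !mulr_ge0.
apply: (norm_le_small AB0) => e e0.
have [d' d'0 Fd'] := Fu _ e0.
(* Capped at 1/2 so that the hats, which reach M + 2 d, stay within M + 1. *)
pose d := Num.min d' (1 / 2).
have d0 : 0 < d by rewrite lt_min d'0 divr_gt0.
have d1 : d <= 1 / 2 by rewrite ge_min lexx orbT.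
have Fd s s' t : `|s - s'| < d -> `|F s t - F s' t| <= e.
  by move=> h; apply: Fd'; apply: lt_le_trans h _; rewrite ge_min lexx.
have [n [h [s [_ h0 h1 h1' hs]]]] := pou d0 M0.
have Fs0 x : M < `|x| -> F x = 0 by move=> Mx; apply: cc_ext => t; rewrite Fs.
have fM x : M < `|x| -> f x = 0 by move=> /Fs0 Mx; rewrite hf Mx (oz0 ob).
have hM k x : (k < n)%N -> M + 1 < `|x| -> h k x = 0.
  move=> kn Mx; have [//|/hs[_ /(_ kn)]] := eqVneq (h k x) 0; lra.
pose S := \sum_(k < n) be (F (s k)) * al (h k).
have e0' := ltW e0.
have l1 : `|al f - S| <= A * (B * e).
  have -> : S = al (\sum_(k < n) be (F (s k)) *: h k).
    by rewrite (oz_sum oa); apply: eq_bigr => k _; rewrite (ozZ oa).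
  rewrite -(ozB oa); apply: HA => x.
    move=> Mx; rewrite ccB cc_sum fM; last by lra.
    rewrite big1 ?subr0// => k _; by rewrite ccZ hM ?mulr0.
  rewrite ccB cc_sum; apply: (@pou_approx _ _ (fun k => h k x) (fun k => be (F (s k)))) => //.
  - by rewrite mulr_ge0.
  - by move=> fx; apply: h1; rewrite leNgt; apply: contra fx => /fM ->.
  - move=> k /hs[hk _]; rewrite hf -(ozB ob); apply: HB => t.
      by move=> Mt; rewrite ccB !Ft// subr0.
    by rewrite ccB; exact: Fd.
have l2 : `|be g - S| <= B * (A * e).
  have -> : S = be (\sum_(k < n) al (h k) *: F (s k)).
    by rewrite (oz_sum ob); apply: eq_bigr => k _; rewrite (ozZ ob) mulrC.
  have gE t : (g - \sum_(k < n) al (h k) *: F (s k)) t =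
      al (G t - \sum_(k < n) F (s k) t *: h k).
    rewrite ccB cc_sum hg (ozB oa) (oz_sum oa); congr (_ - _).
    by apply: eq_bigr => k _; rewrite (ozZ oa) ccZ mulrC.
  rewrite -(ozB ob); apply: HB => t.
    move=> Mt; rewrite gE (_ : _ - _ = 0) ?(oz0 oa)//.
    rewrite big1 ?subr0; first by apply: cc_ext => x; rewrite -FG Ft.
    by move=> k _; rewrite Ft// scale0r.
  rewrite gE; apply: HA => x.
    move=> Mx; rewrite ccB -FG Fs; last by lra.
    by rewrite cc_sum big1 ?subr0// => k _; rewrite ccZ hM ?mulr0.
  rewrite ccB cc_sum; apply: (@pou_approx _ _ (fun k => h k x) (fun k => F (s k) t)) => //.
  - by move=> gx; apply: h1; rewrite leNgt; apply: contra gx => Mx; rewrite -FG Fs.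
  - by move=> k /hs[hk _]; rewrite -FG; exact: Fd.
have -> : al f - be g = (al f - S) - (be g - S) by ring.
apply: le_trans (ler_normB _ _) _; apply: le_trans (lerD l1 l2) _.
by rewrite le_eqVlt; apply/orP; left; apply/eqP; ring.
Qed.

Definition rbounded g := continuous g /\ exists b, forall x, b < x -> g x = 0.

Definition cutoff a x : R := step (x + (1 - a)).

Lemma cutoff_cont a : continuous (cutoff a).
Proof.
apply: smooth_gen_continuous; apply: (@sg_comp _ (@step R) (fun x => x + (1 - a))).
  exact: step_smooth.
by apply: sg_add; [exact: sg_id|exact: sg_cst].
Qed.

Lemma cutoff1 a x : a <= x -> cutoff a x = 1.
Proof. by move=> ax; rewrite /cutoff step_ge1//; lra. Qed.

Lemma cutoff0 a x : x <= a - 1 -> cutoff a x = 0.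
Proof. by move=> ax; rewrite /cutoff step_le0//; lra. Qed.

Lemma cutoff_norm a x v : `|cutoff a x * v| <= `|v|.
Proof.
by rewrite normrM ler_piMl// ger0_norm; [exact: step_le1|exact: step_ge0].
Qed.

(** A test function that agrees with a right-bounded [g] on [[a, +oo[], which is all that a
    functional concentrated there can see; it turns [pairing] into a plain evaluation. *)
Definition cut a g : Cc R := mkcc (fun x => cutoff a x * g x).

Lemma cutE a g : rbounded g -> forall x, cut a g x = cutoff a x * g x.
Proof.
move=> [cg [b gb]] x; rewrite mkccE//; split.
  by move=> z; apply: continuousM; [exact: cutoff_cont|exact: cg].
exists (Num.max (1 - a) b) => z; rewrite gt_max => /andP[h1 h2].
have [z0|z0] := leP 0 z.
  by rewrite ger0_norm// in h2; rewrite gb ?mulr0.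
by rewrite ltr0_norm// in h1; rewrite cutoff0 ?mul0r//; lra.
Qed.

Lemma conc_eq al a phi psi : order_zero al -> conc al `[a, +oo[ ->
  (forall x, a <= x -> phi x = psi x) -> al phi = al psi.
Proof.
move=> oz ca h; apply/eqP; rewrite -subr_eq0 -(ozB oz); apply/eqP; apply: ca => x xa.
by rewrite ccB h ?subrr//; move: xa; rewrite /= in_itv/= andbT.
Qed.

Lemma conc_ge al a a' : a <= a' -> conc al `[a', +oo[ -> conc al `[a, +oo[.
Proof.
move=> aa; apply: conc_sub => x /=; rewrite !in_itv/= !andbT.
exact: le_trans.
Qed.

(** Values obtained from two thresholds both equal that of [al] at the cut of [g] at the smaller
    threshold, so the choice made by [xget] is forced. *)
Lemma pairingE al a g phi : order_zero al -> conc al `[a, +oo[ -> rbounded g ->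
  (forall x, a <= x -> phi x = g x) -> pairing al g = al phi.
Proof.
move=> oz ca rg h; rewrite /pairing; apply: xget_unique.
  exists a => psi hpsi; apply: (conc_eq oz ca) => x ax.
  by rewrite h// hpsi.
move=> v [a' hv].
have min_le x : Num.min a a' <= x -> cut (Num.min a a') g x = g x.
  by move=> mx; rewrite cutE// cutoff1// mul1r.
rewrite -(hv (cut (Num.min a a') g)) => [|x a'x].
  apply: (conc_eq oz ca) => x ax.
  by rewrite h// min_le// ge_min ax.
by rewrite min_le// ge_min a'x orbT.
Qed.

Lemma translate_supp s phi (M : R) : (forall x, M < `|x| -> phi x = 0) ->
  forall t, M + `|s| < `|t| -> translate s phi t = 0.
Proof.
move=> HM t Mt; apply: HM.
have : `|t| <= `|s + t| + `|s|.
  by rewrite -{1}(addrK s t) (le_trans (ler_normB _ _))// [t + s]addrC.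
lra.
Qed.

(** Nearby translates are uniformly close and have their supports in a common compact set, which
    gives continuity; translates by a large [s] vanish on [[b, +oo[]. *)
Lemma inner_rbounded be b phi : order_zero be -> conc be `[b, +oo[ ->
  rbounded (fun s => be (translate s phi)).
Proof.
move=> oz cb; have [M M0 HM] := cc_supp phi; split; last first.
  exists (M - b) => s sM; apply: cb => t /=; rewrite in_itv/= andbT => bt.
  by apply: HM; rewrite ger0_norm; lra.
move=> s; have [C C0 HC] := oz_bound oz (M + (`|s| + 1)).
apply/cvgrPdist_le => e e0.
have C1 : 0 < C + 1 by lra.
have [d d0 Hd] := cc_unif phi (divr_gt0 e0 C1).
near=> s'.
have ss1 : `|s - s'| < 1 by near: s'; apply: cvgr_dist_lt => //; exact: ltr01.
have ssd : `|s - s'| < d by near: s'; apply: cvgr_dist_lt.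
have ns' : `|s'| <= `|s| + 1.
  by rewrite -[s'](subrK s) (le_trans (ler_normD _ _))// distrC addrC lerD2l ltW.
rewrite -(ozB oz); apply: le_trans (HC _ (e / (C + 1)) _ _) _.
- by move=> t Mt; rewrite ccB !(translate_supp HM) ?subrr//; lra.
- by move=> t; rewrite ccB; apply: (Hd (s + t) (s' + t)); rewrite opprD addrACA subrr addr0.
- by rewrite mulrCA ler_piMr ?(ltW e0)// ler_pdivrMr// mul1r; lra.
Unshelve. all: by end_near. Qed.

Lemma convE al be a b phi psi : order_zero al -> conc al `[a, +oo[ ->
  order_zero be -> conc be `[b, +oo[ ->
  (forall s, a <= s -> psi s = be (translate s phi)) -> conv al be phi = al psi.
Proof.
by move=> oa ca ob cb h; apply: (pairingE oa ca) => //; exact: inner_rbounded cb.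
Qed.

Lemma conv_cut al be a b phi : order_zero al -> conc al `[a, +oo[ ->
  order_zero be -> conc be `[b, +oo[ ->
  conv al be phi = al (cut a (fun s => be (translate s phi))).
Proof.
move=> oa ca ob cb; apply: (convE oa ca ob cb) => s asi.
by rewrite cutE ?cutoff1 ?mul1r//; exact: inner_rbounded cb.
Qed.

Lemma translateP s c phi psi : translate s (c *: phi + psi) = c *: translate s phi + translate s psi.
Proof. exact: cc_ext. Qed.

(** The constants depend on [phi] only through the bound [M] on its support. This uniformity yields
    order zero for convolutions and, later, the L^1 bound for regularizations. *)
Lemma conv_cut_bound be (M a b : R) : order_zero be -> conc be `[b, +oo[ -> 0 <= M ->
  exists M' C : R, [/\ 0 <= M', 0 <= C &
    forall phi B, (forall x, M < `|x| -> phi x = 0) -> (forall x, `|phi x| <= B) ->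
      let h := cut a (fun s => be (translate s phi)) in
      (forall x, M' < `|x| -> h x = 0) /\ (forall x, `|h x| <= C * B)].
Proof.
move=> ob cb M0; pose M' := M + `|a| + `|b| + 1.
have M'0 : 0 <= M' by rewrite /M' !addr_ge0.
have [C C0 HC] := oz_bound ob (M + M').
exists M', C; split => // phi B hM hB h.
have hE x : h x = cutoff a x * be (translate x phi).
  by rewrite cutE//; exact: inner_rbounded cb.
have B0 : 0 <= B := le_trans (normr_ge0 _) (hB 0).
have h0 x : M' < `|x| -> h x = 0.
  have := ler_norm (- a); have := ler_norm (- b); rewrite !normrN /M' hE => b1 a1.
  have [x0|x0] := leP 0 x.
    rewrite (ger0_norm x0) => Mx; rewrite cb ?mulr0// => t /=.
    rewrite in_itv/= andbT => bt; apply: hM.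
    by rewrite ger0_norm; have := normr_ge0 a; lra.
  by rewrite (ltr0_norm x0) => Mx; rewrite cutoff0 ?mul0r//; have := normr_ge0 b; lra.
split=> // x; have [xM|/h0->] := leP `|x| M'; last by rewrite normr0 mulr_ge0.
rewrite hE (le_trans (cutoff_norm _ _ _))//; apply: HC => t; last exact: hB.
by move=> Mt; apply: (translate_supp hM); lra.
Qed.

Section Conv.
Variables (al be : Distr R) (a b : R).
Hypotheses (oa : order_zero al) (ca : conc al `[a, +oo[).
Hypotheses (ob : order_zero be) (cb : conc be `[b, +oo[).

Lemma conv_order_zero : order_zero (conv al be).
Proof.
apply: order_zeroP => [c phi psi|M M0].
  rewrite !(conv_cut _ oa ca ob cb) -(ozP oa); congr (al _); apply: cc_ext => s.
  rewrite ccD ccZ !cutE; try exact: inner_rbounded cb.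
  by rewrite translateP (ozP ob) mulrDr mulrCA.
have [M' [C [M'0 C0 HC]]] := conv_cut_bound a ob cb M0.
have [A A0 HA] := oz_bound oa M'.
exists (A * C) => phi B hM hB; rewrite (conv_cut _ oa ca ob cb).
have [h1 h2] := HC phi B hM hB.
by rewrite -mulrA; exact: HA.
Qed.

Lemma conv_conc (F G H : set R) : conc al F -> conc be G ->
  (forall s t, F s -> G t -> H (s + t)) -> conc (conv al be) H.
Proof.
move=> aF bG FG phi hphi; rewrite (conv_cut _ oa ca ob cb); apply: aF => s Fs.
rewrite cutE; last exact: inner_rbounded cb.
by rewrite bG ?mulr0// => t Gt; apply: hphi; exact: FG.
Qed.

Lemma conv_conc_ge : conc (conv al be) `[a + b, +oo[.
Proof.
by apply: conv_conc ca cb _ => s t /=; rewrite !in_itv/= !andbT; exact: lerD.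
Qed.

End Conv.


Lemma step_unif e : 0 < e ->
  exists2 d : R, 0 < d & forall x y, `|x - y| < d -> `|step x - step y| <= e.
Proof.
(* [step] is not compactly supported, but [g] is, and they agree up to 5; beyond 1 [step] is
   constant, so the two ranges overlap enough for points at distance less than 1. *)
move=> e0; pose g x : R := step x + (- 1) * step (x + (- 5)).
have sg : smooth_gen g.
  apply: sg_add; first exact: step_smooth.
  apply: sg_mul; first exact: sg_cst.
  apply: (@sg_comp _ (@step R) (fun x => x + (- 5))); first exact: step_smooth.
  by apply: sg_add; [exact: sg_id|exact: sg_cst].
have cg : ccfun g.
  split; first exact: smooth_gen_continuous.
  exists 6 => x; rewrite /g ltr_normr => /orP[] h.
    by rewrite !step_ge1 ?mulr1 ?subrr//; lra.
  by rewrite !step_le0 ?mulr0 ?addr0//; lra.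
have [d d0 Hd] := cc_unif (mkcc g) e0.
exists (Num.min d 1) => [|x y]; first by rewrite lt_min d0 ltr01.
rewrite lt_min => /andP[/Hd]; rewrite !mkccE//.
rewrite ltr_norml => + /andP[h1 h2].
have [x2|x2] := leP x 2; last first.
  by rewrite !step_ge1 ?subrr ?normr0 ?(ltW e0)//; lra.
by rewrite /g [step (x + _)]step_le0 ?[step (y + _)]step_le0 ?mulr0 ?addr0//; lra.
Qed.

Lemma cutoff_unif a e : 0 < e ->
  exists2 d : R, 0 < d & forall x y, `|x - y| < d -> `|cutoff a x - cutoff a y| <= e.
Proof.
move=> /step_unif[d d0 Hd]; exists d => // x y xy; apply: Hd.
by rewrite opprD addrACA subrr addr0.
Qed.

(** The cut-offs in [s] and [t] make phi(s + t) compactly supported in both variables without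
    changing either iterated pairing, which brings the identity under [order_zero_fubini]. *)
Lemma convC al be a b : order_zero al -> conc al `[a, +oo[ ->
  order_zero be -> conc be `[b, +oo[ -> conv al be = conv be al.
Proof.
move=> oa ca ob cb; apply/funext => phi.
rewrite (conv_cut _ oa ca ob cb) (conv_cut _ ob cb oa ca).
have [M M0 HM] := cc_supp phi.
have [B B0 HB] := cc_bounded phi.
pose K a b s : Cc R := cutoff a s *: mkcc (fun t => cutoff b t * translate s phi t).
have Kcc b' s : ccfun (fun t => cutoff b' t * translate s phi t).
  exact/cc_mul_ccfun/cutoff_cont.
have KE a' b' s t : K a' b' s t = cutoff a' s * (cutoff b' t * phi (s + t)).
  by rewrite /K ccZ mkccE.
pose M' := M + `|a| + `|b| + 1.
have M'0 : 0 <= M' by rewrite /M' !addr_ge0.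
have F0 s t : M' < `|s| \/ M' < `|t| -> cutoff a s * (cutoff b t * phi (s + t)) = 0.
  move=> hst; have [sa|sa] := leP s (a - 1); first by rewrite cutoff0// mul0r.
  have [tb|tb] := leP t (b - 1); first by rewrite [cutoff b _]cutoff0// mul0r mulr0.
  rewrite HM ?mulr0//.
  have := ler_norm (- a); have := ler_norm (- b); have := normr_ge0 a; have := normr_ge0 b.
  rewrite !normrN => lb la nb na.
  suff h : M < s + t by rewrite gtr0_norm; lra.
  by case: hst; rewrite /M' ltr_normr => /orP[]; lra.
have KC s t : K a b s t = K b a t s by rewrite !KE mulrCA addrC.
have Kin a' b' ga s : order_zero ga -> conc ga `[b', +oo[ ->
    cutoff a' s * ga (translate s phi) = ga (K a' b' s).
  move=> og cg; rewrite (ozZ og); congr (_ * _); apply: (conc_eq og cg) => t bt.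
  by rewrite mkccE// cutoff1// mul1r.
apply: (order_zero_fubini (F := K a b) (G := K b a) oa ob M'0) => //.
- by move=> s t h; rewrite KE F0//; left.
- by move=> s t h; rewrite KE F0//; right.
- move=> e e0.
  have B1 : 0 < B + 1 by lra.
  have e20 : 0 < e / 2 by rewrite divr_gt0.
  have [d1 d10 Hd1] := cutoff_unif a (divr_gt0 e20 B1).
  have [d2 d20 Hd2] := cc_unif phi e20.
  exists (Num.min d1 d2) => [|s s' t]; first by rewrite lt_min d10.
  rewrite lt_min => /andP[/Hd1 h1 h2]; rewrite !KE.
  have {}h2 : `|phi (s + t) - phi (s' + t)| <= e / 2.
    by apply: Hd2; rewrite opprD addrACA subrr addr0.
  rewrite (mulrCA _ (cutoff b t)) (mulrCA _ (cutoff b t)) -mulrBr.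
  rewrite (le_trans (cutoff_norm _ _ _))//.
  have -> : cutoff a s * phi (s + t) - cutoff a s' * phi (s' + t) =
    (cutoff a s - cutoff a s') * phi (s + t) +
    cutoff a s' * (phi (s + t) - phi (s' + t)) by rewrite mulrBl mulrBr addrA subrK.
  rewrite (le_trans (ler_normD _ _))// [e]splitr lerD//; last first.
    by rewrite (le_trans (cutoff_norm _ _ _)).
  rewrite normrM; apply: (@le_trans _ _ (e / 2 / (B + 1) * B)).
    by rewrite ler_pM.
  by rewrite -mulrA ler_piMr ?(ltW e20)// mulrC ler_pdivrMr// mul1r; lra.
- by move=> s; rewrite cutE ?(Kin _ _ _ _ ob cb)//; exact: inner_rbounded cb.
- by move=> s; rewrite cutE ?(Kin _ _ _ _ oa ca)//; exact: inner_rbounded ca.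
Qed.

(** No exchange of functionals is involved: both sides apply [ga], then [be], then [al] to phi(r + s
    + t). *)
Lemma convA al be ga a b c : order_zero al -> conc al `[a, +oo[ ->
  order_zero be -> conc be `[b, +oo[ -> order_zero ga -> conc ga `[c, +oo[ ->
  conv al (conv be ga) = conv (conv al be) ga.
Proof.
move=> oa ca ob cb og cg; apply/funext => phi.
have obg := conv_order_zero ob cb og cg; have cbg := conv_conc_ge ob cb og cg.
have oab := conv_order_zero oa ca ob cb; have cab := conv_conc_ge oa ca ob cb.
rewrite (conv_cut _ oab cab og cg) (conv_cut _ oa ca ob cb).
apply: (convE oa ca obg cbg) => r ar.
rewrite cutE; last exact: (inner_rbounded _ ob cb).
rewrite cutoff1// mul1r; apply/esym; apply: (convE ob cb og cg) => s bs.
rewrite [LHS]cutE; last exact: (inner_rbounded _ og cg).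
rewrite cutoff1 ?lerD// mul1r; congr (ga _); apply: cc_ext => t.
by rewrite /= addrA.
Qed.

Lemma dirac0_order_zero : order_zero (@dirac0 R).
Proof.
apply: order_zeroP => [//|M M0]; exists 1 => phi B _ hB.
by rewrite mul1r; exact: hB.
Qed.

Lemma dirac0_conc (F : set R) : F 0 -> conc (@dirac0 R) F.
Proof. by move=> F0 phi; apply. Qed.

Lemma conv1l al a : order_zero al -> conc al `[a, +oo[ -> conv (@dirac0 R) al = al.
Proof.
move=> oa ca; apply/funext => phi.
have c0 : conc (@dirac0 R) `[0, +oo[ by apply: dirac0_conc; rewrite /= in_itv/= lexx.
rewrite (conv_cut _ dirac0_order_zero c0 oa ca) /dirac0 cutE; last exact: inner_rbounded ca.
by rewrite cutoff1// mul1r; congr (al _); apply: cc_ext => t /=; rewrite add0r.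
Qed.

Lemma order_zeroZD c al be : order_zero al -> order_zero be -> order_zero (c *: al + be).
Proof.
move=> oa ob; apply: order_zeroP => [x phi psi|M M0].
  rewrite -![(c *: al + be) _]/(c * al _ + be _) (ozP oa) (ozP ob); ring.
have [A A0 HA] := oz_bound oa M; have [B B0 HB] := oz_bound ob M.
exists (`|c| * A + B) => phi D h1 h2.
rewrite -[(c *: al + be) _]/(c * al _ + be _) (le_trans (ler_normD _ _))//.
by rewrite mulrDl lerD ?HB// normrM -mulrA ler_wpM2l// HA.
Qed.

Lemma concZD c al be F : conc al F -> conc be F -> conc (c *: al + be) F.
Proof.
move=> ha hb phi hphi; rewrite -[LHS]/(c * al _ + be _) ha// hb//.
by rewrite mulr0 addr0.
Qed.

Lemma convDl al be ga a b c : order_zero al -> conc al `[a, +oo[ ->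
  order_zero be -> conc be `[b, +oo[ -> order_zero ga -> conc ga `[c, +oo[ ->
  conv (al + be) ga = conv al ga + conv be ga.
Proof.
move=> oa ca ob cb og cg; apply/funext => phi.
have ca' : conc al `[Num.min a b, +oo[ by apply: conc_ge ca; rewrite ge_min lexx.
have cb' : conc be `[Num.min a b, +oo[ by apply: conc_ge cb; rewrite ge_min lexx orbT.
have oab : order_zero (al + be) by rewrite -[al]scale1r; exact: order_zeroZD.
have cab : conc (al + be) `[Num.min a b, +oo[.
  by rewrite -[al]scale1r; exact: concZD.
rewrite (conv_cut _ oab cab og cg) -[RHS]/(conv al ga phi + conv be ga phi).
by rewrite (conv_cut _ oa ca' og cg) (conv_cut _ ob cb' og cg).
Qed.

End Convolution.

(** * The convolution ring *)

Section MplusRing.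
Variable R : realType.
Implicit Types (al be : Distr R).

Lemma closed_itv_ge (a : R) : closed (`[a, +oo[%classic : set R).
Proof. exact: rray_closed. Qed.

Lemma closed_itv_le (a : R) : closed (`]-oo, a]%classic : set R).
Proof. exact: lray_closed. Qed.

Lemma MplusP al : Mplus al <-> order_zero al /\ exists a : R, conc al `[a, +oo[.
Proof.
split=> -[oz [a ha]]; split=> //; exists a; first exact: conc_dsupp.
by apply: dsupp_conc => //; exact: closed_itv_ge.
Qed.

Definition mplus_pred : {pred Distr R} := mem [set al : Distr R | Mplus al].

Lemma mplus_zmod_closed : zmod_closed mplus_pred.
Proof.
have key c al be : Mplus al -> Mplus be -> Mplus (c *: al + be).
  move=> /MplusP[oa [a ca]] /MplusP[ob [b cb]]; apply/MplusP; split.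
    exact: order_zeroZD.
  exists (Num.min a b); apply: concZD.
    by apply: conc_ge ca; rewrite ge_min lexx.
  by apply: conc_ge cb; rewrite ge_min lexx orbT.
split=> [|al be]; rewrite !inE /=.
  apply/MplusP; split; last by exists 0.
  by apply: order_zeroP => [c phi psi|M M0]; [rewrite mulr0 addr0|exists 0 => phi B _ _; rewrite mul0r normr0].
by move=> ha hb; rewrite addrC -scaleN1r; exact: key.
Qed.

HB.instance Definition _ :=
  GRing.isZmodClosed.Build (Distr R) mplus_pred mplus_zmod_closed.

(** Bundling M_+(R) as a type gives it a commutative ring structure, so that matrix products,
    determinants and adjugates over it obey the usual algebra; [matval] returns to bare
    functionals. *)
Record mplus := MkMplus { mval :> Distr R ; mvalP : mval \in mplus_pred }.

HB.instance Definition _ := [isSub for mval].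
HB.instance Definition _ := [Choice of mplus by <:].
HB.instance Definition _ := [SubChoice_isSubZmodule of mplus by <:].

Implicit Types x y z : mplus.

Lemma mplus_oz x : order_zero x.
Proof. by have := mvalP x; rewrite inE => -[]. Qed.

Lemma mplus_conc x : exists a : R, conc x `[a, +oo[.
Proof. by have := mvalP x; rewrite inE => /MplusP[]. Qed.

Lemma mplus_mul_subproof x y : conv x y \in mplus_pred.
Proof.
have [a ca] := mplus_conc x; have [b cb] := mplus_conc y.
have [ox oy] := (mplus_oz x, mplus_oz y).
rewrite inE; apply/MplusP; split; first exact: conv_order_zero ca oy cb.
by exists (a + b); exact: conv_conc_ge.
Qed.

Definition mplus_mul x y := MkMplus (mplus_mul_subproof x y).

Lemma mplus_one_subproof : @dirac0 R \in mplus_pred.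
Proof.
rewrite inE; apply/MplusP; split; first exact: dirac0_order_zero.
by exists 0; apply: dirac0_conc; rewrite /= in_itv/= lexx.
Qed.

Definition mplus_one := MkMplus mplus_one_subproof.

Lemma mplus_mulA : associative mplus_mul.
Proof.
move=> x y z; apply: val_inj => /=.
have [a ca] := mplus_conc x; have [b cb] := mplus_conc y.
have [c cc] := mplus_conc z.
by apply: convA (mplus_oz x) ca (mplus_oz y) cb (mplus_oz z) cc.
Qed.

Lemma mplus_mulC : commutative mplus_mul.
Proof.
move=> x y; apply: val_inj => /=.
have [a ca] := mplus_conc x; have [b cb] := mplus_conc y.
by apply: convC (mplus_oz x) ca (mplus_oz y) cb.
Qed.

Lemma mplus_mul1 : left_id mplus_one mplus_mul.
Proof.
move=> x; apply: val_inj => /=; have [a ca] := mplus_conc x.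
by apply: conv1l (mplus_oz x) ca.
Qed.

Lemma mplus_mulDl : left_distributive mplus_mul +%R.
Proof.
move=> x y z; apply: val_inj => /=.
have [a ca] := mplus_conc x; have [b cb] := mplus_conc y.
have [c cc] := mplus_conc z.
by apply: convDl (mplus_oz x) ca (mplus_oz y) cb (mplus_oz z) cc.
Qed.

Lemma mplus_one_neq0 : mplus_one != 0.
Proof.
have [n [h [s [_ _ h1 _ _]]]] := pou (@ltr01 R) (lexx 0).
apply/eqP => /(congr1 (fun x : mplus => mval x (\sum_(k < n) h k))).
rewrite -[LHS]/(cc_fun (\sum_(k < n) h k) 0) cc_sum h1 ?normr0// => /eqP.
by rewrite oner_eq0.
Qed.

HB.instance Definition _ := GRing.Zmodule_isComNzRing.Build mplus
  mplus_mulA mplus_mulC mplus_mul1 mplus_mulDl mplus_one_neq0.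

Lemma mvalM x y : mval (x * y) = conv x y. Proof. by []. Qed.
Lemma mval1 : mval 1 = @dirac0 R. Proof. by []. Qed.
Lemma mval0 : mval 0 = 0. Proof. by []. Qed.
Lemma mvalD x y : mval (x + y) = mval x + mval y. Proof. by []. Qed.
Lemma mvalB x y : mval (x - y) = mval x - mval y. Proof. by []. Qed.
Lemma mvalN x : mval (- x) = - mval x. Proof. by []. Qed.

Lemma mval_sum (I : Type) (r : seq I) (P : pred I) (F : I -> mplus) :
  mval (\sum_(i <- r | P i) F i) = \sum_(i <- r | P i) mval (F i).
Proof. exact: (big_morph mval mvalD mval0). Qed.

Lemma mval_inj : injective mval. Proof. exact: val_inj. Qed.

Definition matval p q (A : 'M[mplus]_(p, q)) : 'M[Distr R]_(p, q) := map_mx mval A.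

Lemma matval_inj p q : injective (@matval p q).
Proof.
move=> A B /matrixP h; apply/matrixP => i j; apply: mval_inj.
by have := h i j; rewrite !mxE.
Qed.

Lemma matvalM p q r (A : 'M[mplus]_(p, q)) (B : 'M[mplus]_(q, r)) :
  matval (A *m B) = convmx (matval A) (matval B).
Proof.
apply/matrixP => i j; rewrite !mxE mval_sum; apply: eq_bigr => k _.
by rewrite !mxE.
Qed.

Lemma matvalD p q (A B : 'M[mplus]_(p, q)) : matval (A + B) = matval A + matval B.
Proof. by apply/matrixP => i j; rewrite !mxE. Qed.

Lemma matval1 n : matval (1%:M : 'M[mplus]_n) = dirac_mx R n.
Proof. by apply/matrixP => i j; rewrite !mxE; case: eqP. Qed.

Lemma matval_lift p q (A : 'M[Distr R]_(p, q)) :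
  (forall i j, Mplus (A i j)) -> exists B, matval B = A.
Proof.
move=> hA; have h i j : A i j \in mplus_pred by rewrite inE; exact: hA.
exists (\matrix_(i, j) MkMplus (h i j)).
by apply/matrixP => i j; rewrite !mxE.
Qed.

Lemma convdetE n (A : 'M[mplus]_n) : convdet (matval A) = mval (\det A).
Proof.
rewrite /convdet /determinant mval_sum; apply: eq_bigr => s _.
have E : mval (\prod_(i < n) A i (s i)) = \big[(@conv R)/(@dirac0 R)]_(i < n) matval A i (s i).
  rewrite (big_morph mval mvalM mval1).
  by apply: eq_bigr => i _; rewrite !mxE.
case: (odd_perm s); last by rewrite !expr0 scale1r mul1r -E.
by rewrite !expr1 scaleN1r mulN1r mvalN -E.
Qed.

End MplusRing.

(** * Functions as distributions *)

Section FunctionDistributions.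
Variable R : realType.
Implicit Types (f g : R -> R) (x y s t a b M : R) (phi psi : Cc R).
Local Notation mu := (@lebesgue_measure R).

Definition ival M : set R := `[- M, M]%classic.
Definition locint f := forall M, mu.-integrable (ival M) (EFin \o f).

Lemma ivalP M x : ival M x <-> `|x| <= M.
Proof. by rewrite /ival /= in_itv/= ler_norml. Qed.

Lemma measurable_ival M : measurable (ival M : set (measurableTypeR R)).
Proof. exact: measurable_itv. Qed.
Hint Resolve measurable_ival : core.

Lemma continuous_locint f : continuous f -> locint f.
Proof.
move=> cf M; apply: continuous_compact_integrable; first exact: segment_compact.
exact: continuous_subspaceT.
Qed.

Lemma locint_mulcc f phi M : locint f -> mu.-integrable (ival M) (EFin \o (fun x => f x * phi x)).
Proof.
move=> lf; have -> : EFin \o (fun x => f x * phi x) = ((EFin \o f) \* (EFin \o phi))%E.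
  by apply/funext => x /=; rewrite EFinM.
apply: integrableMl; [exact: measurable_ival|exact: lf| |].
  apply: measurable_funTS; apply: continuous_measurable_fun; exact: cc_continuous.
have [B B0 HB] := cc_bounded phi.
exists B; split; first exact: num_real.
by move=> C BC x _ /=; rewrite (le_trans (HB x))// ltW.
Qed.

Lemma fdistrE f phi M : (forall x, M < `|x| -> phi x = 0) ->
  fdistr f phi = Rintegral mu (ival M) (fun x => f x * phi x).
Proof.
move=> hM; rewrite /fdistr [RHS]Rintegral_mkcond; congr (Rintegral _ _ _).
apply/funext => x; rewrite patchE; case: ifPn => // /negP xM.
by rewrite hM ?mulr0// ltNge; apply/negP => h; apply: xM; rewrite inE; exact/ivalP.
Qed.

Lemma locint_norm f M : locint f -> mu.-integrable (ival M) (EFin \o (fun x => `|f x|)).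
Proof. by move=> lf; apply: integrable_norm. Qed.

Lemma fdistr_bound f phi M B : locint f ->
  (forall x, M < `|x| -> phi x = 0) -> (forall x, `|phi x| <= B) ->
  `|fdistr f phi| <= Rintegral mu (ival M) (fun x => `|f x|) * B.
Proof.
move=> lf hM hB; rewrite (fdistrE _ hM).
have H := le_normr_Rintegral (measurable_ival M) (locint_mulcc phi M lf).
apply: (le_trans H).
rewrite -RintegralZr//; last exact: locint_norm.
apply: le_Rintegral => //.
- by apply: integrable_norm; exact: locint_mulcc.
- have -> : EFin \o (fun x => `|f x| * B) = (fun x => B%:E * (EFin \o (fun x => `|f x|)%R) x)%E.
    by apply/funext => x /=; rewrite -EFinM mulrC.
  by apply: integrableZl => //; exact: locint_norm.
- by move=> x _; rewrite normrM ler_wpM2l.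
Qed.

Lemma fdistr_oz f : locint f -> order_zero (fdistr f).
Proof.
move=> lf; apply: order_zeroP => [c phi psi|M M0]; last first.
  by exists (Rintegral mu (ival M) (fun x => `|f x|)) => phi B h1 h2; exact: fdistr_bound.
have [M1 M10 HM1] := cc_supp phi; have [M2 M20 HM2] := cc_supp psi.
pose M := Num.max M1 M2.
have H1 x : M < `|x| -> phi x = 0 by rewrite gt_max => /andP[/HM1].
have H2 x : M < `|x| -> psi x = 0 by rewrite gt_max => /andP[_ /HM2].
rewrite (fdistrE _ H1) (fdistrE _ H2) (@fdistrE _ _ M); last first.
  by move=> x Mx; rewrite ccD ccZ H1 ?H2// mulr0 addr0.
rewrite -RintegralZl//; last exact: locint_mulcc.
rewrite -RintegralD//; last 2 first.
- have -> : EFin \o (fun x => c * (f x * phi x)) = (fun x => c%:E * (EFin \o (fun x => f x * phi x)%R) x)%E.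
    by apply/funext => x /=; rewrite -EFinM.
  by apply: integrableZl => //; exact: locint_mulcc.
- exact: locint_mulcc.
by apply: eq_Rintegral => x _; rewrite ccD ccZ mulrDr mulrCA.
Qed.

Lemma locintD f g : locint f -> locint g -> locint (fun x => f x + g x).
Proof.
move=> lf lg M; have -> : EFin \o (fun x => f x + g x) = ((EFin \o f) \+ (EFin \o g))%E.
  by apply/funext => x /=; rewrite EFinD.
exact: integrableD.
Qed.

Lemma locintZ c f : locint f -> locint (fun x => c * f x).
Proof.
move=> lf M; have -> : EFin \o (fun x => c * f x) = (fun x => c%:E * (EFin \o f) x)%E.
  by apply/funext => x /=; rewrite -EFinM.
exact: integrableZl.
Qed.

Lemma locint0 : locint (fun=> 0).
Proof. by apply: continuous_locint; exact: cst_continuous. Qed.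

Lemma fdistrD f g : locint f -> locint g ->
  fdistr (fun x => f x + g x) = fdistr f + fdistr g.
Proof.
move=> lf lg; apply/funext => phi; rewrite -[RHS]/(fdistr f phi + fdistr g phi).
have [M M0 HM] := cc_supp phi; rewrite !(fdistrE _ HM) -RintegralD//; try exact: locint_mulcc.
by apply: eq_Rintegral => x _; rewrite mulrDl.
Qed.

Lemma fdistrZ c f : locint f -> fdistr (fun x => c * f x) = c *: fdistr f.
Proof.
move=> lf; apply/funext => phi; rewrite -[RHS]/(c * fdistr f phi).
have [M M0 HM] := cc_supp phi; rewrite !(fdistrE _ HM) -RintegralZl//; try exact: locint_mulcc.
by apply: eq_Rintegral => x _; rewrite mulrA.
Qed.

Lemma fdistr0 : fdistr (fun=> 0 : R) = 0.
Proof.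
apply/funext => phi; have [M M0 HM] := cc_supp phi; rewrite (fdistrE _ HM).
by under eq_Rintegral do rewrite mul0r; rewrite Rintegral_cst// mul0r.
Qed.

Lemma locint_sum n (f : nat -> R -> R) : (forall k, locint (f k)) ->
  locint (fun x => \sum_(k < n) f k x).
Proof.
move=> lf; elim: n => [|n IH].
  have -> : (fun x => \sum_(k < 0) f k x) = fun=> 0 by apply/funext => x; rewrite big_ord0.
  exact: locint0.
have -> : (fun x => \sum_(k < n.+1) f k x) = fun x => (\sum_(k < n) f k x) + f n x.
  by apply/funext => x; rewrite big_ord_recr.
exact: locintD.
Qed.

Lemma fdistr_sum n (f : nat -> R -> R) : (forall k, locint (f k)) ->
  fdistr (fun x => \sum_(k < n) f k x) = \sum_(k < n) fdistr (f k).
Proof.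
move=> lf; elim: n => [|n IH].
  rewrite big_ord0 -fdistr0; congr (fdistr _).
  by apply/funext => x; rewrite big_ord0.
rewrite big_ord_recr /= -IH -fdistrD//; last exact: locint_sum.
by congr (fdistr _); apply/funext => x; rewrite big_ord_recr.
Qed.

Lemma locint_restrict f (F : set R) : measurable F -> locint f -> locint (f \_ F).
Proof.
move=> mF lf M; rewrite -restrict_EFin; apply/integrable_restrict => //.
by apply: integrableS (lf M) => //; exact: measurableI.
Qed.

Lemma fdistr_conc f (F : set R) : (forall x, ~ F x -> f x = 0) -> conc (fdistr f) F.
Proof.
move=> hf phi hphi; have [M M0 HM] := cc_supp phi; rewrite (fdistrE _ HM).
have h x : f x * phi x = 0.
  by have [/hphi->|/hf->] := pselect (F x); rewrite ?mulr0 ?mul0r.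
by under eq_Rintegral do rewrite h; rewrite Rintegral_cst// mul0r.
Qed.

Lemma ae_impl (P Q : R -> Prop) : (forall x, P x -> Q x) ->
  {ae mu, forall x, P x} -> {ae mu, forall x, Q x}.
Proof.
by move=> PQ; apply: filterS; [exact: (ae_filter_ringOfSetsType mu)|exact: PQ].
Qed.

Lemma ae_all (P : R -> Prop) : (forall x, P x) -> {ae mu, forall x, P x}.
Proof. by move=> hP; exact: aeW. Qed.

Lemma Rintegral_dominated (f_ : nat -> R -> R) f g M :
  (forall n, mu.-integrable (ival M) (EFin \o f_ n)) ->
  measurable_fun (ival M : set (measurableTypeR R)) f ->
  mu.-integrable (ival M) (EFin \o g) ->
  {ae mu, forall x, ival M x -> f_ n x @[n --> \oo] --> f x} ->
  {ae mu, forall x, ival M x -> forall n, `|f_ n x| <= g x} ->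
  mu.-integrable (ival M) (EFin \o f) /\
  Rintegral mu (ival M) (f_ n) @[n --> \oo] --> Rintegral mu (ival M) f.
Proof.
move=> if_ mf ig cf dom.
have H1 : {ae mu, forall x, ival M x -> (EFin \o f_ n) x @[n --> \oo] --> (EFin \o f) x}.
  apply: ae_impl cf => x h /h fx; apply/fine_cvgP; split => //.
  exact: nearW.
have H2 : {ae mu, forall x n, ival M x -> (`|(EFin \o f_ n) x| <= (EFin \o g) x)%E}.
  by apply: ae_impl dom => x h n /h; rewrite /= lee_fin; exact.
have [iff _ lim] := dominated_convergence (measurable_ival M)
  (fun n => measurable_int mu (if_ n)) (proj2 (measurable_EFinP _ _) mf) H1 ig H2.
split=> //; apply: fine_cvg; rewrite fineK; first exact: lim.
exact: integrable_fin_num.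
Qed.

(** Multiplying [phi] by min(1, n c) gives test functions that vanish on [F] and converge to [phi]
    off [F]; by dominated convergence the integral of f phi off [F] is zero. The function [c]
    presents [F] as a zero set, which also makes it measurable. *)
Lemma fdistr_restrict f (c : R -> R) (F : set R) : locint f -> continuous c ->
  (forall x, 0 <= c x) -> (forall x, F x <-> c x = 0) ->
  conc (fdistr f) F -> fdistr f = fdistr (f \_ F).
Proof.
move=> lf cc c0 Fc cF; apply/funext => phi.
have mF : measurable (F : set (measurableTypeR R)).
  have -> : F = c @^-1` [set 0] by apply/seteqP; split => x /Fc.
  rewrite -[X in measurable X]setTI.
  by apply: (continuous_measurable_fun cc) => //; exact: measurable_set1.
have [M M0 HM] := cc_supp phi.
pose rho n x := Num.min 1 (n%:R * c x).
have crho n : continuous (rho n).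
  move=> x; apply: (@continuous_min _ _ (fun=> 1) (fun x => n%:R * c x)); first exact: cvg_cst.
  by apply: continuousM; [exact: cvg_cst|exact: cc].
have rho01 n x : 0 <= rho n x <= 1.
  by rewrite /rho le_min ler01 mulr_ge0//= ge_min lexx.
pose g x := f x * phi x - (f \_ F) x * phi x.
have zero n : Rintegral mu (ival M) (fun x => f x * (rho n x * phi x)) = 0.
  have rcc : ccfun (fun x => rho n x * phi x) by exact: cc_mul_ccfun.
  rewrite -[RHS](cF (mkcc (fun x => rho n x * phi x))) => [|x /Fc cx].
    rewrite (@fdistrE _ _ M) => [|x /HM h]; last by rewrite mkccE// h mulr0.
    by apply: eq_Rintegral => x _; rewrite mkccE.
  by rewrite mkccE// /rho cx mulr0 min_r ?ler01// mul0r.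
have [|||||_ lim] := @Rintegral_dominated (fun n x => f x * (rho n x * phi x)) g
  (fun x => `|f x * phi x|) M.
- move=> n; have rcc : ccfun (fun x => rho n x * phi x) by exact: cc_mul_ccfun.
  have := @locint_mulcc f (mkcc (fun x => rho n x * phi x)) M lf.
  by congr (integrable _ _ _); apply/funext => x /=; rewrite mkccE.
- apply/measurable_EFinP; apply: (measurable_int mu (f := EFin \o g)).
  have := integrableB (measurable_ival M) (locint_mulcc phi M lf)
    (locint_mulcc phi M (locint_restrict mF lf)).
  by congr (integrable _ _ _); apply/funext => x /=; rewrite EFinB.
- by apply: integrable_norm; exact: locint_mulcc.
- apply: ae_all => x _; rewrite /g patchE.
  have [/set_mem /Fc cx|/negP xF] := boolP (x \in F).
    rewrite subrr; apply: cvg_near_cst; apply: nearW => n.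
    by rewrite /rho cx mulr0 min_r ?ler01// mul0r mulr0.
  have cx : 0 < c x.
    by rewrite lt_neqAle c0 andbT eq_sym; apply/eqP => /Fc h; apply: xF; rewrite inE.
  rewrite mul0r subr0; apply: cvg_near_cst.
  have := nbhs_infty_gtr ((c x)^-1); apply: filterS => n hn.
  by rewrite /rho min_l ?mul1r// -ler_pdivrMr// div1r ltW.
- apply: ae_all => x _ n; rewrite mulrCA normrM ler_piMl//.
  by have /andP[h1 h2] := rho01 n x; rewrite ger0_norm.
have g0 : Rintegral mu (ival M) g = 0.
  have E : (fun n => Rintegral mu (ival M) (fun x => f x * (rho n x * phi x))) = fun=> 0.
    by apply/funext.
  move: lim; rewrite E => lim; apply: (cvg_unique _ lim); first exact: norm_hausdorff.
  exact: cvg_cst.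
rewrite !(fdistrE _ HM); apply/eqP; rewrite -subr_eq0 -RintegralB//.
- by rewrite -[X in X == _]/(Rintegral mu (ival M) g) g0.
- exact: locint_mulcc.
- by apply: locint_mulcc; exact: locint_restrict.
Qed.

End FunctionDistributions.

(** * Summable series of locally integrable functions *)

Section Series.
Variable R : realType.
Implicit Types (f g : R -> R) (x y s t a b M : R) (phi psi : Cc R).
Local Notation mu := (@lebesgue_measure R).
Local Hint Resolve measurable_ival : core.

Lemma locint_measurable f M : locint f ->
  measurable_fun (ival M : set (measurableTypeR R)) f.
Proof. by move=> lf; apply/measurable_EFinP; exact: (measurable_int mu (lf M)). Qed.

(** Completeness of L^1_loc in the form used below: the sum [G] of the absolute values is integrable
    on each interval by monotone convergence, hence finite almost everywhere, and dominates the
    partial sums. *)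
Lemma fdistr_series (g_ : nat -> R -> R) : (forall k, locint (g_ k)) ->
  (forall M, exists B : R, forall n,
     \sum_(k < n) Rintegral mu (ival M) (fun x => `|g_ k x|) <= B) ->
  exists2 g, locint g & forall phi,
    fdistr (fun x => \sum_(k < n) g_ k x) phi @[n --> \oo] --> fdistr g phi.
Proof.
move=> lg hB.
pose G x : \bar R := (\sum_(0 <= k <oo) `|g_ k x|%:E)%E.
pose S n x := \sum_(k < n) g_ k x.
(* The upper limit is measurable without any convergence assumption, and is the sum of the series
   wherever [G] is finite. *)
pose g x := fine (limn_esup (fun n => (S n x)%:E)).
have G0 x : (0 <= G x)%E by apply: nneseries_ge0 => k _ _; rewrite lee_fin.
have SG n x : ((\sum_(k < n) `|g_ k x|)%:E <= G x)%E.
  rewrite -(big_mkord xpredT (fun k => `|g_ k x|)) -sumEFin.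
  by apply: nneseries_lim_ge => k _ _; rewrite lee_fin.
have mS n M : measurable_fun (ival M : set (measurableTypeR R)) (S n).
  by apply: locint_measurable; exact: locint_sum.
have mabs k M : measurable_fun (ival M : set (measurableTypeR R)) (fun x => `|g_ k x|%:E).
  by apply/measurable_EFinP; apply: measurableT_comp => //; exact: locint_measurable.
have mG M : measurable_fun (ival M : set (measurableTypeR R)) G.
  by apply: ge0_emeasurable_sum => // k x _ _; rewrite lee_fin.
have iG M : mu.-integrable (ival M) G.
  apply/integrableP; split => //.
  under eq_integral do rewrite gee0_abs//.
  rewrite integral_nneseries//.
  have [B HB] := hB M.
  apply: (@le_lt_trans _ _ B%:E); last exact: ltry.
  apply: lime_le.
    by apply: is_cvg_nneseries => k _ _; apply: integral_ge0 => x _; rewrite lee_fin.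
  apply: nearW => n; rewrite big_mkord.
  rewrite (_ : (\sum_(k < n) _)%E = (\sum_(k < n) Rintegral mu (ival M) (fun x => `|g_ k x|))%:E).
    by rewrite lee_fin.
  rewrite -sumEFin; apply: eq_bigr => k _; rewrite /Rintegral fineK//.
  apply: integrable_fin_num => //; exact: locint_norm.
have ifG M : mu.-integrable (ival M) (EFin \o (fine \o G)).
  apply: le_integrable (iG M) => //.
    by apply/measurable_EFinP; apply: measurableT_comp => //; exact: fine_measurable.
  by move=> x _ /=; rewrite [leRHS]gee0_abs//; case: (G x) (G0 x) => [r||]//= r0; rewrite ger0_norm.
have Gfin M : {ae mu, forall x, ival M x -> G x \is a fin_num}.
  exact: integrable_ae.
have Sg x : G x \is a fin_num -> S n x @[n --> \oo] --> g x.
  move=> fG.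
  have SE : S^~ x = series (g_^~ x).
    by apply/funext => n; rewrite /S /series/= big_mkord.
  have cS : cvgn (series (g_^~ x)).
    apply: normed_cvg; apply: nondecreasing_is_cvgn.
      by apply/nondecreasing_seqP => n; rewrite /= !seriesEnat /= big_nat_recr//= lerDl.
    exists (fine (G x)) => _ [n _ <-] /=; rewrite -lee_fin fineK//.
    by rewrite seriesEnat/= big_mkord.
  have cE : (fun n => (S n x)%:E) @ \oo --> (limn (series (g_^~ x)))%:E.
    by apply/fine_cvgP; split; [exact: nearW|rewrite /comp/= -SE in cS *].
  have -> : g x = limn (series (g_^~ x)).
    rewrite /g is_cvg_limn_esupE; last by apply/cvg_ex; eexists; exact: cE.
    by rewrite (cvg_lim _ cE).
  by rewrite SE.
have Sle n x : G x \is a fin_num -> `|S n x| <= fine (G x).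
  move=> fG; rewrite -lee_fin fineK// (le_trans _ (SG n x))// lee_fin.
  exact: ler_norm_sum.
have mg M : measurable_fun (ival M : set (measurableTypeR R)) g.
  apply: measurableT_comp; first exact: fine_measurable.
  by apply: measurable_fun_limn_esup => n; apply/measurable_EFinP.
exists g => [M|phi].
  have [] // := @Rintegral_dominated _ S g (fine \o G) M => [n||].
  - exact: locint_sum.
  - by apply: ae_impl (Gfin M) => x h /h; exact: Sg.
  - by apply: ae_impl (Gfin M) => x h /h Gx n; exact: Sle.
have [M M0 HM] := cc_supp phi; have [B B0 HB] := cc_bounded phi.
rewrite (fdistrE _ HM); under eq_fun do rewrite (fdistrE _ HM).
have [] // := @Rintegral_dominated _ (fun n x => S n x * phi x) (fun x => g x * phi x)
   (fun x => B * fine (G x)) M => [n||||].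
- by apply: locint_mulcc; exact: locint_sum.
- apply: measurable_funM => //; apply: measurable_funTS.
  by apply: continuous_measurable_fun; exact: cc_continuous.
- have := integrableZl (measurable_ival M) B (ifG M).
  by congr (integrable _ _ _).
- apply: ae_impl (Gfin M) => x h /h Gx; apply: cvgM; last exact: cvg_cst.
  exact: Sg.
- apply: ae_impl (Gfin M) => x h /h Gx n; rewrite normrM mulrC ler_pM//.
  exact: Sle.
Qed.

End Series.

(** * Convolving with functions *)

Section ConvolutionFunctions.
Variable R : realType.
Implicit Types (f g : R -> R) (x y s t a b M : R) (phi psi : Cc R) (al : Distr R).
Local Notation mu := (@lebesgue_measure R).
Local Hint Resolve measurable_ival : core.
(** Lebesgue measure viewed as an order-zero functional, so that [order_zero_fubini] also exchanges
    a functional and an integral. *)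
Local Notation lam := (fdistr (fun=> 1 : R)).

Lemma lam_oz : order_zero lam.
Proof. by apply: fdistr_oz; apply: continuous_locint; exact: cst_continuous. Qed.

Lemma Rintegral_suppE f (D : set R) M : ival M `<=` D ->
  (forall x, M < `|x| -> f x = 0) ->
  Rintegral mu D f = Rintegral mu (ival M) f.
Proof.
move=> MD hf; rewrite [LHS]Rintegral_mkcond [RHS]Rintegral_mkcond.
congr (Rintegral _ _ _); apply/funext => x; rewrite !patchE.
have [xM|Mx] := leP `|x| M.
  have xI : ival M x by exact/ivalP.
  by rewrite !mem_set//; exact: MD.
by rewrite hf//; do 2 case: ifP.
Qed.

Lemma lam_translate s phi : lam (translate s phi) = lam phi.
Proof.
have [M M0 HM] := cc_supp phi.
pose M' := M + `|s|.
have M'0 : 0 <= M' by rewrite addr_ge0.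
have := ler_norm s; have := ler_norm (- s); rewrite normrN => s1 s2.
rewrite (fdistrE _ (translate_supp HM)) -/M' (fdistrE _ HM).
pose F x := s + x.
rewrite -[RHS](@Rintegral_suppE _ `[F (- M'), F M']) /=; last 2 first.
- move=> x /ivalP; rewrite ler_norml => /andP[h1 h2].
  by rewrite /= in_itv/= /F /M'; apply/andP; split; lra.
- by move=> x /HM ->; rewrite mulr0.
have dF x : is_derive x (1 : R) F 1.
  by have := is_deriveD (is_derive_cst s x (1:R)) (is_derive_id x (1 : R)); rewrite add0r.
have F' : F^`()%classic = fun=> 1.
  by apply/funext => x; rewrite derive1E; have := dF x => ?; rewrite derive_val.
have cF : continuous F by move=> x; apply: continuousD; [exact: cvg_cst|exact: cvg_id].
congr fine.
rewrite (@integration_by_substitution_increasing _ F (fun x => 1 * phi x) (- M') M').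
- by apply: eq_integral => x _ /=; rewrite F' fctE/= mulr1.
- by lra.
- by move=> x y _ _ xy; rewrite /F ltrD2l.
- by rewrite F' => x _; exact: cvg_cst.
- by rewrite F'; exact: is_cvg_cst.
- by rewrite F'; exact: is_cvg_cst.
- split; first by move=> x _; exact: ex_derive.
    by apply: cvg_at_right_filter; exact: cF.
  by apply: cvg_at_left_filter; exact: cF.
- apply: continuous_subspaceT => x; apply: continuousM; first exact: cvg_cst.
  exact: cc_continuous.
Qed.

Lemma cc_reflect phi : ccfun (fun t => phi (- t)).
Proof.
split; last by have [M _ HM] := cc_supp phi; exists M => x Mx; rewrite HM// normrN.
move=> x; apply: (@continuous_comp _ _ _ (fun t : R => - t) phi).
  by apply: continuousN; exact: cvg_id.
exact: cc_continuous.
Qed.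

(* [<al_s, psi(x - s)>], the value at [x] of [al * psi]. *)
Definition regularize al psi x : R := al (translate (- x) (mkcc (fun t => psi (- t)))).

Lemma regularize_cont al a psi : order_zero al -> conc al `[a, +oo[ ->
  continuous (regularize al psi).
Proof.
move=> oa ca x; have [c _] := inner_rbounded (mkcc (fun t => psi (- t))) oa ca.
apply: (@continuous_comp _ _ _ (fun t : R => - t) (fun s => al (translate s _))).
  by apply: continuousN; exact: cvg_id.
exact: c.
Qed.

Lemma fdistr_cc_conc psi a : (forall x, x < a -> psi x = 0) -> conc (fdistr psi) `[a, +oo[.
Proof.
move=> h; apply: fdistr_conc => x /=; rewrite in_itv/= andbT => /negP.
by rewrite -ltNge; exact: h.
Qed.

Lemma cc_left psi : exists a : R, forall x, x < a -> psi x = 0.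
Proof.
have [M M0 HM] := cc_supp psi; exists (- M) => x xM.
by apply: HM; rewrite ltr0_norm; lra.
Qed.

Lemma cc_locint psi : locint psi.
Proof. by apply: continuous_locint; exact: cc_continuous. Qed.

(** Translation invariance turns the integral of psi(x) phi(s + x) into that of psi(x - s) phi(x);
    Fubini then applies [al] in [s] before integrating in [x]. *)
Lemma conv_regularize al a psi : order_zero al -> conc al `[a, +oo[ ->
  conv al (fdistr psi) = fdistr (regularize al psi).
Proof.
move=> oa ca; apply/funext => phi.
have [b hb] := cc_left psi; have cb := fdistr_cc_conc hb.
have ob := fdistr_oz (cc_locint psi).
rewrite (conv_cut _ oa ca ob cb).
have [Mp Mp0 HMp] := cc_supp phi; have [Ms Ms0 HMs] := cc_supp psi.
have [Bp Bp0 HBp] := cc_bounded phi; have [Bs Bs0 HBs] := cc_bounded psi.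
have csub s : continuous (fun x => psi (x - s)).
  move=> x; apply: (@continuous_comp _ _ _ (fun t : R => t - s) psi).
    by apply: continuousB; [exact: cvg_id|exact: cvg_cst].
  exact: cc_continuous.
have cc1 s : ccfun (fun x => psi (x - s) * phi x) by exact: cc_mul_ccfun.
pose psir x := translate (- x) (mkcc (fun t => psi (- t))).
have psirE x s : psir x s = psi (x - s).
  by rewrite /psir /= mkccE; [congr (psi _); ring|exact: cc_reflect].
have cc2 x : ccfun (fun s => cutoff a s * psir x s).
  by apply: cc_mul_ccfun; exact: cutoff_cont.
have cc3 : ccfun (fun x => regularize al psi x * phi x).
  by apply: cc_mul_ccfun; exact: regularize_cont ca.
pose F s := cutoff a s *: mkcc (fun x => psi (x - s) * phi x).
pose G x := phi x *: mkcc (fun s => cutoff a s * psir x s).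
have FE s x : F s x = cutoff a s * (psi (x - s) * phi x) by rewrite ccZ mkccE.
have -> : fdistr (regularize al psi) phi = lam (mkcc (fun x => regularize al psi x * phi x)).
  rewrite /fdistr; congr (Rintegral _ _ _); apply/funext => x.
  by rewrite mul1r mkccE.
have M0 : 0 <= Mp + Ms by rewrite addr_ge0.
apply: (order_zero_fubini (F := F) (G := G) oa lam_oz M0).
- by move=> s x; rewrite FE ccZ mkccE// psirE; ring.
- move=> s x Ms'; rewrite FE.
  have [xM|/HMp->] := leP `|x| Mp; last by rewrite !mulr0.
  rewrite HMs ?mul0r ?mulr0//.
  have : `|s| <= `|x| + `|x - s| by rewrite -{1}(subKr x s) ler_normB.
  lra.
- by move=> s x Mx; rewrite FE [phi x]HMp ?mulr0//; lra.
- move=> e e0.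
  pose D := (Bs + 1) * (Bp + 1).
  have D0 : 0 < D by rewrite mulr_gt0//; lra.
  have e1 : 0 < e / D / 2 by rewrite !divr_gt0.
  have [d1 d10 Hd1] := cutoff_unif a e1.
  have [d2 d20 Hd2] := cc_unif psi e1.
  exists (Num.min d1 d2) => [|s s' x]; first by rewrite lt_min d10.
  rewrite lt_min => /andP[/Hd1 h1 h2]; rewrite !FE.
  have {}h2 : `|psi (x - s) - psi (x - s')| <= e / D / 2.
    by apply: Hd2; rewrite opprB addrC addrA subrK distrC.
  rewrite !mulrA -mulrBl normrM.
  have -> : cutoff a s * psi (x - s) - cutoff a s' * psi (x - s') =
    (cutoff a s - cutoff a s') * psi (x - s) +
    cutoff a s' * (psi (x - s) - psi (x - s')) by rewrite mulrBl mulrBr addrA subrK.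
  apply: (@le_trans _ _ ((e / D / 2 * (Bs + 1) + e / D / 2 * (Bs + 1)) * (Bp + 1))); last first.
    rewrite -mulrDl -splitr -mulrA divfK ?gt_eqF//.
  apply: ler_pM => //; last by rewrite (le_trans (HBp _))//; lra.
  apply: le_trans (ler_normD _ _) _; apply: lerD.
    by rewrite normrM ler_pM// (le_trans (HBs _))//; lra.
  rewrite (le_trans (cutoff_norm _ _ _))// (le_trans h2)// ler_peMr ?(ltW e1)//; lra.
- move=> s; rewrite cutE; last exact: inner_rbounded cb.
  rewrite (ozZ lam_oz); congr (_ * _); rewrite -(lam_translate s) /fdistr.
  congr (Rintegral _ _ _); apply/funext => x; rewrite mul1r /= mkccE//.
  by rewrite addrAC subrr add0r.
- move=> x; rewrite mkccE// (ozZ oa) mulrC; congr (_ * _).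
  by apply: (conc_eq oa ca) => s asi; rewrite mkccE// cutoff1// mul1r.
Qed.

Lemma lam_le phi psi : (forall x, phi x <= psi x) -> lam phi <= lam psi.
Proof.
move=> h; rewrite -subr_ge0 -(ozB lam_oz); apply: Rintegral_ge0 => x _.
by rewrite mul1r ccB subr_ge0.
Qed.

Definition plateau M x : R := cutoff (- M) x * cutoff (- M) (- x).

Lemma plateau_cont M : continuous (plateau M).
Proof.
move=> x; apply: continuousM; first exact: cutoff_cont.
apply: (@continuous_comp _ _ _ (fun t : R => - t) (cutoff (- M))).
  by apply: continuousN; exact: cvg_id.
exact: cutoff_cont.
Qed.

Lemma plateau1 M x : `|x| <= M -> plateau M x = 1.
Proof. by rewrite ler_norml => /andP[h1 h2]; rewrite /plateau !cutoff1 ?mulr1//; lra. Qed.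

Lemma plateau0 M x : M + 1 < `|x| -> plateau M x = 0.
Proof.
rewrite ltr_normr => /orP[] h; rewrite /plateau; last by rewrite cutoff0 ?mul0r//; lra.
by rewrite [X in _ * X]cutoff0 ?mulr0//; lra.
Qed.

Lemma plateau01 M x : 0 <= plateau M x <= 1.
Proof.
by rewrite /plateau mulr_ge0 ?step_ge0//= mulr_ile1 ?step_ge0 ?step_le1.
Qed.

Lemma plateau_cc M f : continuous f -> ccfun (fun x => plateau M x * f x).
Proof.
move=> cf; split; first by move=> x; apply: continuousM; [exact: plateau_cont|exact: cf].
by exists (M + 1) => x /plateau0 ->; rewrite mul0r.
Qed.

(* Duality: testing [g] against [g / (|g| + e)] recovers its L^1 norm. *)
Lemma L1_dual f M C : continuous f -> 0 <= M ->
  (forall psi, (forall x, M + 1 < `|x| -> psi x = 0) -> (forall x, `|psi x| <= 1) ->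
    `|fdistr f psi| <= C) ->
  Rintegral mu (ival M) (fun x => `|f x|) <= C.
Proof.
move=> cf M0 hC.
have cabs : continuous (fun x => `|f x|).
  by move=> x; apply: (@continuous_comp _ _ _ f (fun t : R => `|t|)); [exact: cf|exact: norm_continuous].
pose chi := mkcc (fun x => plateau M x * 1).
have chiE x : chi x = plateau M x.
  by rewrite mkccE ?mulr1//; apply: plateau_cc; exact: cst_continuous.
pose K := lam chi.
have K0 : 0 <= K by apply: Rintegral_ge0 => x _; rewrite mul1r chiE; case/andP: (plateau01 M x).
pose h := mkcc (fun x => plateau M x * `|f x|).
have hE x : h x = plateau M x * `|f x| by rewrite mkccE//; exact: plateau_cc.
apply: (@le_trans _ _ (lam h)).
  rewrite (@fdistrE _ _ _ (M + 1)); last by move=> x Mx; rewrite hE plateau0// mul0r.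
  pose f1 := (fun x => `|f x|) \_ (ival M).
  have -> : Rintegral mu (ival M) (fun x => `|f x|) = Rintegral mu (ival (M + 1)) f1.
    rewrite (@Rintegral_suppE f1 (ival (M + 1)) M).
    - by apply: eq_Rintegral => x xM; rewrite xM.
    - by move=> x /ivalP xM; apply/ivalP; lra.
    - move=> x Mx; rewrite /f1 /patch memNset// => /ivalP; lra.
  have labs : locint (fun x => `|f x|) by exact: continuous_locint.
  apply: le_Rintegral => //.
  - by apply: locint_restrict labs _; exact: measurable_ival.
  - by apply: locint_mulcc; apply: continuous_locint; exact: cst_continuous.
  - move=> x _; rewrite mul1r hE /f1 /patch; case: ifPn => [/set_mem/ivalP xM|_].
      by rewrite plateau1// mul1r.
    by rewrite mulr_ge0//; case/andP: (plateau01 M x).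
apply/ler_addgt0Pr => d d0.
have K1 : 0 < K + 1 by lra.
pose e := d / (K + 1); have e0 : 0 < e by rewrite divr_gt0.
have den x : 0 < `|f x| + e by rewrite ltr_wpDl.
pose psi := mkcc (fun x => plateau M x * (f x / (`|f x| + e))).
have psiE x : psi x = plateau M x * (f x / (`|f x| + e)).
  rewrite mkccE//; apply: plateau_cc => z.
  have c2 : {for z, continuous (fun x => (`|f x| + e)^-1)}.
    apply: continuousV; first by rewrite gt_eqF.
    by apply: (@continuousD _ _ _ (fun x => `|f x|) (fun=> e) z); [exact: cabs|exact: cst_continuous].
  exact: (continuousM (cf z) c2).
pose fpsi := mkcc (fun x => f x * psi x).
have fpsiE x : fpsi x = f x * psi x by rewrite mkccE//; exact: cc_mul_ccfun.
apply: (@le_trans _ _ (lam (fpsi + e *: chi))).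
  apply: lam_le => x; rewrite ccD ccZ fpsiE hE psiE chiE.
  have /andP[p0 _] := plateau01 M x.
  rewrite [X in X + _](_ : _ = plateau M x * (`|f x| ^+ 2 / (`|f x| + e))); last first.
    by rewrite real_normK ?num_real//; ring.
  rewrite [e * _]mulrC -mulrDr ler_wpM2l//.
  rewrite -lerBlDr ler_pdivlMr// -subr_ge0.
  have -> : `|f x| ^+ 2 - (`|f x| - e) * (`|f x| + e) = e ^+ 2 by ring.
  exact: sqr_ge0.
rewrite (ozD lam_oz) (ozZ lam_oz); apply: lerD.
  have -> : lam fpsi = fdistr f psi.
    by rewrite /fdistr; congr (Rintegral _ _ _); apply/funext => x; rewrite mul1r fpsiE.
  apply: le_trans (ler_norm _) (hC _ _ _) => x.
    by move=> Mx; rewrite psiE plateau0// mul0r.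
  have /andP[p0 p1] := plateau01 M x.
  rewrite psiE normrM (ger0_norm p0) mulr_ile1// normrM normfV (gtr0_norm (den x)).
  by rewrite ler_pdivrMr// mul1r lerDl ltW.
by rewrite -/K /e mulrAC ler_pdivrMr// ler_pM2l//; lra.
Qed.

(** By [L1_dual] it suffices to test against [phi] bounded by 1. Commutativity moves [al] from [psi]
    onto [phi], where [conv_cut_bound] controls size and support; the common left bound [b] is what
    makes the cut independent of [psi]. *)
Lemma regularize_L1_bound al a b M : order_zero al -> conc al `[a, +oo[ -> 0 <= M ->
  exists N C : R, [/\ 0 <= N, 0 <= C & forall psi, (forall x, x < b -> psi x = 0) ->
    Rintegral mu (ival M) (fun x => `|regularize al psi x|) <=
    C * Rintegral mu (ival N) (fun x => `|psi x|)].
Proof.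
move=> oa ca M0; have M1 : 0 <= M + 1 by lra.
have [N [C [N0 C0 HC]]] := conv_cut_bound b oa ca M1.
exists N, C; split=> // psi hpsi.
apply: L1_dual => //; first exact: regularize_cont ca.
move=> phi hphi phi1.
have ob := fdistr_oz (cc_locint psi); have cb := fdistr_cc_conc hpsi.
have [h1 h2] := HC phi 1 hphi phi1.
rewrite -(conv_regularize _ oa ca) (convC oa ca ob cb) (conv_cut _ ob cb oa ca).
rewrite mulrC; rewrite mulr1 in h2; exact: (fdistr_bound (cc_locint psi) h1 h2).
Qed.

End ConvolutionFunctions.

(** * Locally integrable functions as an ideal for convolution *)

Section Ideal.
Variable R : realType.
Implicit Types (f g : R -> R) (x y s t a b M : R) (phi psi : Cc R) (al : Distr R).
Local Notation mu := (@lebesgue_measure R).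
Local Hint Resolve measurable_ival : core.

(** Continuous functions are dense in L^1 of the interval. The plateau equals 1 there, and to the
    left of [b], where [f] vanishes, the cut-off only shrinks the approximant, so the error does not
    grow. *)
Lemma cc_dense f b M e : locint f -> (forall x, x < b -> f x = 0) -> 0 < e ->
  exists2 h : Cc R, (forall x, x < b - 1 -> h x = 0) &
    Rintegral mu (ival M) (fun x => `|f x - h x|) <= e.
Proof.
move=> lf f0 e0.
have mfin : (mu (ival M) < +oo)%E.
  by apply: compact_finite_measure; exact: segment_compact.
have [g_ [cg ig lim]] := approximation_continuous_integrable (measurable_ival M) mfin (lf M).
have : (fun n => Rintegral mu (ival M) (fun x => `|f x - g_ n x|)) @ \oo --> (0 : R).
  by apply: fine_cvg; exact: lim.
move=> /cvgrPdist_lt /(_ _ e0) [n _ /(_ n (leqnn n))] /=.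
rewrite sub0r normrN => he.
pose h := mkcc (fun x => plateau M x * (cutoff b x * g_ n x)).
have hE x : h x = plateau M x * (cutoff b x * g_ n x).
  rewrite mkccE//; apply: plateau_cc => {}x.
  by apply: continuousM; [exact: cutoff_cont|exact: cg].
exists h => [x xb|]; first by rewrite hE cutoff0 ?mul0r ?mulr0//; lra.
apply: le_trans _ (ltW (le_lt_trans (ler_norm _) he)).
have lB k : locint k -> mu.-integrable (ival M) (EFin \o (fun x => `|f x - k x|)).
  move=> lk; apply: (@locint_norm _ (fun x => f x - k x)).
  have := locintD lf (locintZ (-1) lk).
  by congr locint; apply/funext => x; rewrite mulN1r.
apply: (le_Rintegral (measurable_ival M)).
- exact: (lB h (cc_locint h)).
- exact: (lB (g_ n) (continuous_locint (cg n))).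
move=> x /ivalP xM; rewrite hE plateau1// mul1r.
have [xb|bx] := ltP x b; last by rewrite cutoff1// mul1r.
by rewrite f0// !sub0r !normrN; exact: cutoff_norm.
Qed.

Lemma geometric_partial_sum (r : nat -> R) (c : R) N : 0 <= c -> (forall k, 0 <= r k) ->
  (forall k, (N <= k)%N -> r k <= c * 2^-1 ^+ k) ->
  exists B : R, forall n, \sum_(k < n) r k <= B.
Proof.
(* The sum in [D] absorbs the first [N] terms, so that the geometric bound holds for every index. *)
move=> c0 r0 rc; pose D := c + \sum_(k < N) r k * 2 ^+ k.
have sk k : (k < N)%N -> r k * 2 ^+ k <= \sum_(k < N) r k * 2 ^+ k.
  move=> kN; rewrite (bigD1 (Ordinal kN))//= lerDl sumr_ge0// => j _.
  by rewrite mulr_ge0// exprn_ge0.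
have s0 : 0 <= \sum_(k < N) r k * 2 ^+ k.
  by rewrite sumr_ge0// => j _; rewrite mulr_ge0// exprn_ge0.
have rD k : r k <= D * 2^-1 ^+ k.
  have [Nk|kN] := leqP N k.
    by apply: le_trans (rc _ Nk) _; rewrite ler_wpM2r ?exprn_ge0 ?invr_ge0// lerDl.
  rewrite exprVn -ler_pdivrMr ?invr_gt0 ?exprn_gt0// invrK.
  by apply: le_trans (sk _ kN) _; rewrite lerDr.
exists (D * 2) => n; apply: (@le_trans _ _ (\sum_(k < n) D * 2^-1 ^+ k)).
  by apply: ler_sum => k _; exact: rD.
rewrite -mulr_sumr ler_wpM2l ?addr_ge0//.
have -> : \sum_(k < n) 2^-1 ^+ k = 2 - 2 * 2^-1 ^+ n :> R.
  elim: n => [|n IH]; first by rewrite big_ord0 expr0; ring.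
  by rewrite big_ord_recr /= IH exprS; field.
by rewrite lerBlDr lerDl mulr_ge0// exprn_ge0// invr_ge0.
Qed.

Lemma le_Rintegral_ival f M N : locint f -> M <= N ->
  Rintegral mu (ival M) (fun x => `|f x|) <= Rintegral mu (ival N) (fun x => `|f x|).
Proof.
move=> lf MN; pose f1 := (fun x => `|f x|) \_ (ival M).
have labs : locint (fun x => `|f x|) by move=> K; exact: locint_norm.
have -> : Rintegral mu (ival M) (fun x => `|f x|) = Rintegral mu (ival N) f1.
  rewrite (@Rintegral_suppE _ f1 (ival N) M).
  - by apply: eq_Rintegral => x xM; rewrite xM.
  - by move=> x /ivalP xM; apply/ivalP; lra.
  - by move=> x Mx; rewrite /f1 /patch memNset// => /ivalP; lra.
apply: (le_Rintegral (measurable_ival _)) => //.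
- by apply: locint_restrict labs _; exact: measurable_ival.
- by move=> x _; rewrite /f1 /patch; case: ifP => // _; exact: normr_ge0.
Qed.

(** Write [f] as a telescoping series of test functions converging fast in L^1 on every interval.
    Regularization sends it to a series of continuous functions that is summable in L^1_loc, and the
    sum is identified by moving [al] onto the test function. *)
Theorem conv_fdistr al a b f : order_zero al -> conc al `[a, +oo[ ->
  locint f -> conc (fdistr f) `[b, +oo[ ->
  exists2 g, locint g & conv al (fdistr f) = fdistr g.
Proof.
move=> oa ca lf' cf'.
pose f0 := f \_ (`[b, +oo[%classic : set R).
have mb : measurable (`[b, +oo[%classic : set (measurableTypeR R)) by exact: measurable_itv.
have lf : locint f0 by exact: locint_restrict.
have ff0 : fdistr f = fdistr f0.
  apply: (@fdistr_restrict _ _ (fun x => Num.max (b - x) 0)) => //.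
  - move=> x; apply: (@continuous_max _ _ (fun x => b - x) (fun=> 0)); last exact: cvg_cst.
    by apply: continuousB; [exact: cvg_cst|exact: cvg_id].
  - by move=> x; rewrite le_max lexx orbT.
  - move=> x /=; rewrite in_itv/= andbT; split => h; first by rewrite max_r// subr_le0.
    by rewrite -subr_le0; apply: contra_eqT h; rewrite -ltNge => h; rewrite max_l ?gt_eqF// ltW.
rewrite ff0; have cf : conc (fdistr f0) `[b, +oo[ by rewrite -ff0.
have f0b x : x < b -> f0 x = 0.
  by move=> xb; rewrite /f0 patchE memNset//= in_itv/= andbT; apply/negP; rewrite -ltNge.
have e0 n : 0 < 2^-1 ^+ n :> R by rewrite exprn_gt0// invr_gt0.
have exh n : {h : Cc R | (forall x, x < b - 1 -> h x = 0) /\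
    Rintegral mu (ival n%:R) (fun x => `|f0 x - h x|) <= 2^-1 ^+ n}.
  by apply: cid; have [h h1 h2] := @cc_dense f0 b n%:R _ lf f0b (e0 n); exists h.
pose h n := sval (exh n).
have hb n x : x < b - 1 -> h n x = 0 by have [+ _] := svalP (exh n); exact.
have fh n : Rintegral mu (ival n%:R) (fun x => `|f0 x - h n x|) <= 2^-1 ^+ n.
  by have [] := svalP (exh n).
(* Increments of the approximants: their partial sums up to index [n] give back [h n]. *)
pose u n : Cc R := if n is k.+1 then h k.+1 - h k else h 0.
have ub n x : x < b - 1 -> u n x = 0.
  by case: n => [|n] xb; rewrite /u ?hb// ccB !hb// subrr.
have uh n x : \sum_(k < n.+1) u k x = h n x.
  elim: n => [|n IH]; first by rewrite big_ord_recl big_ord0 addr0.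
  by rewrite big_ord_recr /= IH addrC subrK.
pose g_ n := regularize al (u n).
have lg n : locint (g_ n) by apply: continuous_locint; exact: regularize_cont ca.
have lfh n : locint (fun x => f0 x - h n x).
  have := locintD lf (locintZ (-1) (cc_locint (h n))).
  by congr locint; apply/funext => x; rewrite mulN1r.
have [|g lg' lim] := @fdistr_series _ g_ lg.
  move=> M0; pose M := Num.max M0 0.
  have MM : M0 <= M by rewrite le_max lexx.
  have M00 : 0 <= M by rewrite le_max lexx orbT.
  have [N [C [N0 C0 HC]]] := regularize_L1_bound (b - 1) oa ca M00.
  pose r k := Rintegral mu (ival N) (fun x => `|u k x|).
  have r0 k : 0 <= r k by apply: Rintegral_ge0.
  have [B HB] : exists B : R, forall n, \sum_(k < n) r k <= B.
    (* The increment of index k + 1 has norm at most 2^-k + 2^-(k+1) = 3 * 2^-(k+1) as soon as N <=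
       k, since the estimate for [h k] holds on [-k, k]; the threshold trunc(N) + 2 on k + 1 ensures
       this. *)
    apply: (@geometric_partial_sum r 3 (Num.trunc N).+2) => // -[//|k] Nk.
    have Nk' : N <= k%:R.
      apply: ltW; apply: lt_le_trans (truncnS_gt _) _; rewrite ler_nat.
      exact: Nk.
    have h1 := le_trans (le_Rintegral_ival (lfh k) Nk') (fh k).
    have Nk1 : N <= k.+1%:R by rewrite (le_trans Nk')// ler_nat.
    have h2 := le_trans (le_Rintegral_ival (lfh k.+1) Nk1) (fh k.+1).
    have -> : 3 * 2^-1 ^+ k.+1 = 2^-1 ^+ k + 2^-1 ^+ k.+1 :> R by rewrite exprS; field.
    apply: le_trans _ (lerD h1 h2).
    rewrite -(RintegralD (measurable_ival _))//; try exact: locint_norm.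
    apply: (le_Rintegral (measurable_ival _)) => //; first exact/locint_norm/cc_locint.
      have := locintD (fun M => locint_norm M (lfh k)) (fun M => locint_norm M (lfh k.+1)).
      exact.
    move=> x _; rewrite ccB.
    have -> : h k.+1 x - h k x = (f0 x - h k x) - (f0 x - h k.+1 x) by ring.
    exact: ler_normB.
  exists (C * B) => n; apply: (@le_trans _ _ (\sum_(k < n) C * r k)); last first.
    by rewrite -mulr_sumr ler_wpM2l.
  apply: ler_sum => k _; apply: le_trans _ (HC _ (ub k)).
  exact: le_Rintegral_ival.
exists g => //; apply/funext => phi.
have ofd psi : order_zero (fdistr psi) by apply: fdistr_oz; exact: cc_locint.
have cfd n : conc (fdistr (h n)) `[b - 1, +oo[ by apply: fdistr_cc_conc; exact: hb.
have cud n : conc (fdistr (u n)) `[b - 1, +oo[ by apply: fdistr_cc_conc; exact: ub.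
have of0 := fdistr_oz lf.
have cf1 : conc (fdistr f0) `[b - 1, +oo[ by apply: conc_ge cf; lra.
(* One test function [H] serves [f0] and all its approximants, since all of them are concentrated on
   [[b - 1, +oo[]. *)
pose H := cut (b - 1) (fun s => al (translate s phi)).
have convH k : order_zero (fdistr k) -> conc (fdistr k) `[b - 1, +oo[ ->
    conv al (fdistr k) phi = fdistr k H.
  by move=> ok ck; rewrite (convC oa ca ok ck) (conv_cut _ ok ck oa ca).
have [M M0 HM] := cc_supp H; have [B B0 HB] := cc_bounded H.
rewrite convH//.
have lim1 : (fun n => fdistr (fun x => \sum_(k < n.+1) g_ k x) phi : R) @ \oo --> (fdistr g phi : R).
  exact: (cvg_comp (fun n => n.+1) _ (cvg_addnl 1) (lim phi)).
apply/esym; apply: (cvg_unique _ lim1); first exact: norm_hausdorff.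
have gE n : fdistr (fun x => \sum_(k < n.+1) g_ k x) phi = fdistr (h n) H.
  rewrite fdistr_sum//.
  have -> : (\sum_(k < n.+1) fdistr (g_ k)) phi = \sum_(k < n.+1) fdistr (g_ k) phi.
    exact: (big_morph (fun d : Distr R => d phi)).
  under eq_bigr => k _ do rewrite -(conv_regularize _ oa ca) convH//.
  have <- : (\sum_(k < n.+1) fdistr (u k)) H = \sum_(k < n.+1) fdistr (u k) H.
    exact: (big_morph (fun d : Distr R => d H)).
  rewrite -(@fdistr_sum R n.+1 (fun k => u k)); last by move=> k; exact: cc_locint.
  by congr (fdistr _ _); apply/funext => x; rewrite uh.
rewrite (funext gE).
apply/cvgrPdist_le => e e00.
have B1 : 0 < B + 1 by lra.
near=> n.
have fhE : fdistr f0 H - fdistr (h n) H = fdistr (fun x => f0 x - h n x) H.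
  rewrite (_ : (fun x => f0 x - h n x) = fun x => f0 x + (-1) * h n x); last first.
    by apply/funext => x; rewrite mulN1r.
  rewrite fdistrD//; last exact/locintZ/cc_locint.
  rewrite fdistrZ; last exact: cc_locint.
  by rewrite -[RHS]/(fdistr f0 H + (-1) * fdistr (h n) H) mulN1r.
rewrite fhE; apply: le_trans (fdistr_bound (lfh n) HM HB) _.
have Mn : M <= n%:R.
  apply: ltW; apply: lt_le_trans (truncnS_gt _) _; rewrite ler_nat.
  by near: n; exact: nbhs_infty_gt.
apply: (@le_trans _ _ (2^-1 ^+ n * B)).
  by rewrite ler_wpM2r//; exact: le_trans (le_Rintegral_ival (lfh n) Mn) (fh n).
apply: (@le_trans _ _ (e / (B + 1) * B)); last first.
  by rewrite mulrAC ler_pdivrMr// ler_pM2l//; lra.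
rewrite ler_wpM2r//; near: n.
have : (2^-1 ^+ n) @[n --> \oo] --> (0 : R).
  by apply: cvg_expr; rewrite gtr0_norm ?invr_gt0// invf_lt1// ltr1n.
move=> /cvgrPdist_le /(_ _ (divr_gt0 e00 B1)); apply: filterS => n.
by rewrite sub0r normrN ger0_norm ?(ltW (e0 n)).
Unshelve. all: by end_near. Qed.

End Ideal.

(** * Supports in the half-lines *)

Section Application.
Variable R : realType.
Implicit Types (f g : R -> R) (phi psi : Cc R) (al : Distr R) (x y z : mplus R).
Local Notation mu := (@lebesgue_measure R).
Local Notation nonpos := (`]-oo, (0:R)]%classic : set R).

(** For elements of [mplus], whose support is already bounded on the left, this amounts to
    membership in M(R_-). *)
Definition neg x := conc x nonpos.

Lemma nonposP (t : R) : nonpos t <-> t <= 0.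
Proof. by rewrite /= in_itv. Qed.

Lemma neg1 : neg 1. Proof. by apply: dirac0_conc; exact/nonposP. Qed.

Lemma negD x y : neg x -> neg y -> neg (x + y).
Proof. by move=> hx hy; rewrite /neg mvalD -[mval x]scale1r; exact: concZD. Qed.

Lemma negN x : neg x -> neg (- x).
Proof.
by move=> hx; rewrite /neg mvalN -scaleN1r -[_ *: _]addr0; exact: concZD.
Qed.

Lemma negB x y : neg x -> neg y -> neg (x - y).
Proof. by move=> hx hy; apply: negD => //; exact: negN. Qed.

Lemma mplus_conc_mul x y (F G H : set R) : conc x F -> conc y G ->
  (forall s t, F s -> G t -> H (s + t)) -> conc (x * y) H.
Proof.
have [a ca] := mplus_conc x; have [b cb] := mplus_conc y.
by rewrite mvalM; apply: (conv_conc (mplus_oz x) ca (mplus_oz y) cb).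
Qed.

Lemma negM x y : neg x -> neg y -> neg (x * y).
Proof.
move=> hx hy; apply: mplus_conc_mul hx hy _ => s t /nonposP hs /nonposP ht.
by apply/nonposP; lra.
Qed.

Lemma neg_sum (I : Type) (r : seq I) (P : pred I) (F : I -> mplus R) :
  (forall i, P i -> neg (F i)) -> neg (\sum_(i <- r | P i) F i).
Proof. by move=> h; elim/big_ind: _ => //; exact: negD. Qed.

Lemma neg_prod (I : Type) (r : seq I) (P : pred I) (F : I -> mplus R) :
  (forall i, P i -> neg (F i)) -> neg (\prod_(i <- r | P i) F i).
Proof. by move=> h; elim/big_ind: _ => //; [exact: neg1|exact: negM]. Qed.

Definition negmx p q (A : 'M[mplus R]_(p, q)) := forall i j, neg (A i j).

Lemma negmxM p q r (A : 'M[mplus R]_(p, q)) (B : 'M[mplus R]_(q, r)) :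
  negmx A -> negmx B -> negmx (A *m B).
Proof. by move=> hA hB i j; rewrite mxE; apply: neg_sum => k _; exact: negM. Qed.

Lemma negmxB p q (A B : 'M[mplus R]_(p, q)) : negmx A -> negmx B -> negmx (A - B).
Proof. by move=> hA hB i j; rewrite !mxE; exact: negB. Qed.

Lemma neg_det n (A : 'M[mplus R]_n) : negmx A -> neg (\det A).
Proof.
move=> hA; apply: neg_sum => s _; apply: negM; last by apply: neg_prod => i _.
by case: (odd_perm s); rewrite ?expr1 ?expr0; [apply: negN|]; exact: neg1.
Qed.

Lemma negmx_adj n (A : 'M[mplus R]_n) : negmx A -> negmx (\adj A).
Proof.
move=> hA i j; rewrite mxE /cofactor; apply: negM.
  by rewrite -signr_odd; case: (odd _); rewrite ?expr1 ?expr0; [apply: negN|]; exact: neg1.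
by apply: neg_det => k l; rewrite !mxE.
Qed.

Lemma Mminus_Mplus al : Mminus al -> Mplus al.
Proof.
move=> [oz /compact_itv[M M0 KM] _]; split=> //; exists (- M) => t /KM.
by rewrite ler_norml /= in_itv/= andbT => /andP[].
Qed.

Lemma Mminus_neg x : Mminus x -> neg x.
Proof. by move=> [oz _ h]; exact: conc_dsupp. Qed.

Lemma dsupp_closed al : closed (dsupp al).
Proof.
rewrite -openC openE => t ht.
have [U [oU Ut hU]] : exists U : set R, [/\ open U, U t &
    forall phi, fsupp phi `<=` U -> al phi = 0].
  apply: contrapT => h; apply: ht => U oU Ut; apply: contrapT => h'.
  apply: h; exists U; split => // phi hphi; apply/eqP/negPn/negP => ac.
  by apply: h'; exists phi.
apply: filterS (open_nbhs_nbhs (conj oU Ut)) => s Us /(_ U oU Us)[phi hphi].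
by rewrite hU// eqxx.
Qed.

Lemma neg_Mminus x : neg x -> Mminus x.
Proof.
move=> nx; have [a ca] := mplus_conc x.
have h0 := dsupp_conc (@closed_itv_le _ _) nx; have ha := dsupp_conc (@closed_itv_ge _ _) ca.
split=> //; first exact: mplus_oz.
apply: (@subclosed_compact _ _ `[a, 0]); first exact: dsupp_closed.
  exact: segment_compact.
move=> t dt; have := h0 _ dt; have := ha _ dt.
by rewrite /= !in_itv/= andbT => -> ->.
Qed.

Definition isfun x := exists2 f, locint f & mval x = fdistr f.

Lemma isfunD x y : isfun x -> isfun y -> isfun (x + y).
Proof.
move=> [f lf xf] [g lg yg]; exists (fun t => f t + g t); first exact: locintD.
by rewrite mvalD xf yg fdistrD.
Qed.

Lemma isfun_sum (I : Type) (r : seq I) (P : pred I) (F : I -> mplus R) :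
  (forall i, P i -> isfun (F i)) -> isfun (\sum_(i <- r | P i) F i).
Proof.
move=> h; elim/big_ind: _ => //; last exact: isfunD.
by exists (fun=> 0); [exact: locint0|rewrite fdistr0].
Qed.

Lemma isfunM x y : isfun y -> isfun (x * y).
Proof.
move=> [f lf yf]; have [a ca] := mplus_conc x; have [b cb] := mplus_conc y.
rewrite yf in cb; have [g lg xg] := conv_fdistr (mplus_oz x) ca lf cb.
by exists g => //; rewrite mvalM yf xg.
Qed.

Lemma measurable_nonneg : measurable (`[0, +oo[%classic : set (measurableTypeR R)).
Proof. exact: measurable_itv. Qed.

Lemma locint_ext0 f : locint f -> locint (ext0 f).
Proof. by apply: locint_restrict; exact: measurable_nonneg. Qed.

Lemma ext0_conc f : conc (fdistr (ext0 f)) `[0, +oo[.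
Proof. by apply: fdistr_conc => t ht; rewrite /ext0 patchE memNset. Qed.

Lemma ext0_lift f : locint (ext0 f) -> exists x, mval x = fdistr (ext0 f).
Proof.
move=> lf; have h : fdistr (ext0 f) \in @mplus_pred R.
  rewrite inE; apply/MplusP; split; first exact: fdistr_oz.
  by exists 0; exact: ext0_conc.
by exists (MkMplus h).
Qed.

Lemma ext0_neg f x y : locint f -> mval x = fdistr f -> mval y = fdistr (ext0 f) ->
  neg (x - y).
Proof.
move=> lf xf yf phi hphi; rewrite mvalB xf yf.
rewrite -[LHS]/(fdistr f phi - fdistr (ext0 f) phi).
apply/eqP; rewrite subr_eq0; apply/eqP; congr (Rintegral _ _ _); apply/funext => t.
have [t0|t0] := leP t 0; first by rewrite hphi ?mulr0//; exact/nonposP.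
by rewrite /ext0 patchE mem_set//= in_itv/= ltW.
Qed.

Lemma Gamma1_locint f : Gamma1 f -> locint (ext0 f).
Proof.
move=> h M; rewrite /ext0 -restrict_EFin; apply/(integrable_restrict _ measurable_nonneg).
  exact: measurable_ival.
apply: h => [|t []//].
apply: (@subclosed_compact _ _ (ival M)); last by move=> t [].
  by apply: closedI; [exact: itv_closed|exact: closed_itv_ge].
exact: segment_compact.
Qed.

Lemma locint_Gamma1 f : locint f -> Gamma1 f.
Proof.
move=> lf K cK _; have [M M0 KM] := compact_itv cK.
apply: integrableS (lf M).
- exact: measurable_ival.
- exact: compact_measurable.
- by move=> t /KM tM; exact/ivalP.
Qed.

Lemma convfunE p q (A : 'M[mplus R]_(p, q)) (Y : 'cV[mplus R]_q) (f : 'I_q -> R -> R) :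
  (forall j, mval (Y j 0) = fdistr (f j)) ->
  forall i, convfun (matval A) f i = mval ((A *m Y) i 0).
Proof.
move=> hY i; rewrite /convfun mxE mval_sum; apply: eq_bigr => j _.
by rewrite mvalM hY mxE.
Qed.

Lemma trunc_eq x y : neg (x - y) <-> trunc x = trunc y.
Proof.
split=> [/conc_trunc h|h].
  apply/funext => phi; apply/eqP; rewrite -subr_eq0; apply/eqP.
  exact: (congr1 (fun t => t phi) h).
apply: trunc_conc; first exact: mplus_oz.
apply/funext => phi; have := congr1 (fun t => t phi) h.
rewrite /trunc => h'; rewrite -[LHS]/(mval x (sval phi) - mval y (sval phi)).
by rewrite h' subrr.
Qed.

End Application.

(** * Sufficiency *)

Section Systems.
Variables (R : realType) (d m : nat) (Sigma : pseudo_rational R d m).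

(** The data of the system carried into the ring [mplus], where the two inverse relations become
    ordinary matrix identities. *)
Record lifted (Q Qi : 'M[mplus R]_d) (P : 'M[mplus R]_(d, m)) : Prop := Lifted {
  lift_Q : matval Q = psQ Sigma ;
  lift_Qi : matval Qi = psQinv Sigma ;
  lift_P : matval P = psP Sigma ;
  lift_negQ : negmx Q ;
  lift_negP : negmx P ;
  lift_QiQ : Qi *m Q = 1%:M ;
  lift_QQi : Q *m Qi = 1%:M }.

Lemma negmx_lift p q (A : 'M[mplus R]_(p, q)) (B : 'M[Distr R]_(p, q)) :
  matval A = B -> (forall i j, Mminus (B i j)) -> negmx A.
Proof.
move=> AB hB i j; apply: Mminus_neg; have := hB i j.
by rewrite -AB mxE.
Qed.

Lemma lifted_exists : exists Q Qi P, lifted Q Qi P.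
Proof.
have [Q hQ] := matval_lift (fun i j => Mminus_Mplus (psQ_Mminus Sigma i j)).
have [P hP] := matval_lift (fun i j => Mminus_Mplus (psP_Mminus Sigma i j)).
have [Qi hQi] := matval_lift (psQinv_Mplus Sigma).
exists Q, Qi, P; split => //.
- exact: negmx_lift hQ (psQ_Mminus Sigma).
- exact: negmx_lift hP (psP_Mminus Sigma).
- by apply: matval_inj; rewrite matvalM hQ hQi psQinvQ matval1.
- by apply: matval_inj; rewrite matvalM hQ hQi psQQinv matval1.
Qed.

Section Lifted.
Variables (Q Qi : 'M[mplus R]_d) (P : 'M[mplus R]_(d, m)).
Hypothesis L : lifted Q Qi P.

Lemma impulse_lift : impulse_response Sigma = matval (Qi *m P).
Proof. by rewrite matvalM (lift_Qi L) (lift_P L). Qed.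

Lemma Omega1_of_isfun (x : mplus R) (T : R) : isfun x ->
  conc x (`[- T, 0]%classic : set R) ->
  exists u, [/\ Omega1 u, dsupp (fdistr u) `<=` `[- T, 0] & mval x = fdistr u].
Proof.
(* [Omega1] wants an integer endpoint that is at least 1, whereas the support is bounded by the real
   [T]; [n] dominates both. *)
move=> [f lf xf] cx; pose n := (Num.trunc (Num.max T 1)).+1.
have Tn : T <= n%:R by rewrite ltW// (le_lt_trans _ (truncnS_gt _))// le_max lexx.
pose D : set R := `[- n%:R, 0]%classic.
have mD : measurable (D : set (measurableTypeR R)) by exact: measurable_itv.
have E : fdistr f = fdistr (f \_ D).
  (* The maximum of - n - t, t and 0 is continuous with zero set [D]. *)
  apply: (@fdistr_restrict _ _ (fun t => Num.max (Num.max (- n%:R - t) t) 0)) => //.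
  - move=> t; apply: (@continuous_max _ _ (fun t : R => Num.max (- n%:R - t) t) (fun=> 0)); last exact: cvg_cst.
    apply: (@continuous_max _ _ (fun t : R => - n%:R - t) (fun t => t)); last exact: cvg_id.
    by apply: continuousB; [exact: cvg_cst|exact: cvg_id].
  - by move=> t; rewrite le_max lexx orbT.
  - move=> t; rewrite /D /= in_itv/=; split => [/andP[h1 h2]|h].
      by rewrite max_r// ge_max subr_le0 h1 h2.
    have : Num.max (Num.max (- n%:R - t) t) 0 <= 0 by rewrite h.
    by rewrite !ge_max subr_le0 => /andP[].
  - rewrite -xf; apply: conc_sub cx => t; rewrite /D /= !in_itv/= => /andP[h1 ->].
    by rewrite andbT (le_trans _ h1)// lerN2.
exists (f \_ D); split; last by rewrite xf E.
- exists n; split => //.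
    rewrite -restrict_EFin; apply/integrable_restrict; [exact: mD|exact: mD|].
    apply: integrableS (lf n%:R); [exact: measurable_ival|exact: measurableI|].
    move=> t [+ _]; rewrite /D /= in_itv/= => /andP[h1 h2]; apply/ivalP.
    by rewrite ler_norml h1 (le_trans h2).
  by move=> t ht; rewrite patchE memNset// => ht'; move/negP: ht; apply.
- rewrite -E -xf; apply: dsupp_conc cx; exact: itv_closed.
Qed.

Lemma coprime_reachable (T : R) :
  (- linf (convdet (psQ Sigma)) < T%:E)%E -> left_coprime Sigma -> reachable_in Sigma T.
Proof.
move=> hT [A' [B' [hA hB AB]]] y [yG yT].
have [A EA] := matval_lift (fun i j => Mminus_Mplus (hA i j)).
have [B EB] := matval_lift (fun i j => Mminus_Mplus (hB i j)).
have nA := negmx_lift EA hA.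
have nB := negmx_lift EB hB.
have QAPB : Q *m A + P *m B = 1%:M.
  by apply: matval_inj; rewrite matvalD !matvalM (lift_Q L) (lift_P L) EA EB matval1.
have ly j := Gamma1_locint (yG j).
have /choice[Yf hYf] j := ext0_lift (ly j).
pose Y : 'cV[mplus R]_d := \col_j Yf j.
have YE j : mval (Y j 0) = fdistr (ext0 (y j)) by rewrite mxE hYf.
pose W := Q *m Y.
have nW : negmx W.
  move=> i j; rewrite ord1; apply: trunc_conc; first exact: mplus_oz.
  by rewrite -(convfunE Q YE) (lift_Q L) yT.
pose q := \det Q; pose qi := \det Qi.
have qqi : q * qi = 1 by rewrite -det_mulmx (lift_QQi L) det1.
(* With [A] and [B] in the roles of R and S, [Z] is q^-1 S w, [Zp] its restriction to [0, +oo[, and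
   [Z - Zp] the correction z. *)
pose Z := qi *: (B *m W).
(* Reassociating exhibits [Z] as a matrix of measures applied to [Y], whose entries are functions;
   the ideal property concludes. *)
have fZ l : isfun (Z l 0).
  rewrite /Z /W mulmxA scalemxAl mxE; apply: isfun_sum => k _; apply: isfunM.
  by exists (ext0 (y k)).
have /choice[zf hz] l : exists f, locint f /\ mval (Z l 0) = fdistr f.
  by have [f lf xf] := fZ l; exists f.
have lz l := (hz l).1; have zE l := (hz l).2.
have /choice[Zpf hZp] l := ext0_lift (locint_ext0 (lz l)).
pose Zp : 'cV[mplus R]_m := \col_l Zpf l.
have ZpE l : mval (Zp l 0) = fdistr (ext0 (zf l)) by rewrite mxE hZp.
have nZ : negmx (Z - Zp).
  by move=> l j; rewrite ord1 !mxE; apply: (ext0_neg (lz l)); rewrite -?zE ?mxE// hZp.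
pose U := q *: Zp.
have UE : U = B *m W - q *: (Z - Zp).
  rewrite scalerBr /Z scalerA qqi scale1r /U opprB addrC subrK//.
have nq : neg q by apply: neg_det; exact: lift_negQ L.
have nqmx p r (M : 'M[mplus R]_(p, r)) : negmx M -> negmx (q *: M).
  by move=> nM i j; rewrite mxE; exact: negM.
(* The left end comes from U = q Zp, with q on [[- T, +oo[] by the hypothesis on [T] and Zp on [0,
   +oo[; the right end from the other expression, U = S w - q z. *)
have cU l : conc (U l 0) (`[- T, 0]%classic : set R).
  have cq : conc q (`[- T, +oo[%classic : set R).
    apply: conc_dsupp; first exact: mplus_oz.
    move=> t dt; rewrite /= in_itv/= andbT.
    have : (linf (convdet (psQ Sigma)) <= t%:E)%E.
      by apply: ereal_inf_lbound; exists t => //; rewrite -(lift_Q L) convdetE.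
    move=> lt; rewrite -lee_fin EFinN leeNl ltW//.
    by apply: le_lt_trans hT; rewrite leeN2.
  have h1 : conc (U l 0) (`[- T, +oo[%classic : set R).
    rewrite mxE; apply: (mplus_conc_mul (F := `[- T, +oo[%classic) (G := `[0, +oo[%classic)) => //.
      by rewrite ZpE; exact: ext0_conc.
    by move=> s t; rewrite /= !in_itv/= !andbT => h1 h2; lra.
  have h2 : neg (U l 0) by rewrite UE; apply: negmxB; [exact: negmxM|exact: nqmx].
  have := concI (mplus_oz _) (@closed_itv_ge _ _) (@closed_itv_le _ _) h1 h2.
  by apply: conc_sub => t [] /=; rewrite !in_itv/= andbT => -> ->.
have fU l : isfun (U l 0).
  rewrite mxE; apply: isfunM; exists (ext0 (zf l)) => //; exact: locint_ext0.
have /choice[u hu] l := Omega1_of_isfun (fU l) (cU l).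
exists u; split=> [l|l|i]; [by have [] := hu l|by have [] := hu l|].
have uE l : mval (U l 0) = fdistr (u l) by have [] := hu l.
rewrite impulse_lift (convfunE _ uE) -YE; apply/trunc_eq.
have -> : ((Qi *m P) *m U) i 0 - Y i 0 = ((Qi *m P) *m U - Y) i 0 by rewrite !mxE.
(* Coprimeness gives Q^-1 P S w = y - R w, and q Q^-1 = adj Q absorbs the inverse in the correction,
   so both remaining terms are supported in ]-oo, 0]. *)
suff -> : (Qi *m P) *m U - Y = - (A *m W) - \adj Q *m P *m (Z - Zp).
  apply: negmxB.
    by move=> k l; rewrite mxE; apply: negN; exact: negmxM.
  apply: negmxM => //; apply: negmxM; last exact: lift_negP L.
  by apply: negmx_adj; exact: lift_negQ L.
have PB : P *m B = 1%:M - Q *m A by rewrite -QAPB addrC addKr.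
have adjE : \adj Q = q *: Qi.
  by rewrite -[LHS]mulmx1 -(lift_QQi L) mulmxA mul_adj_mx mul_scalar_mx.
have YW : Y = Qi *m W by rewrite /W mulmxA (lift_QiQ L) mul1mx.
have -> : Qi *m P *m U = Y - A *m W - \adj Q *m P *m (Z - Zp).
  rewrite UE mulmxBr; congr (_ - _).
    have -> : Qi *m P *m (B *m W) = Qi *m (P *m B) *m W by rewrite !mulmxA.
    by rewrite PB mulmxBr mulmx1 mulmxBl -YW (mulmxA Qi Q A) (lift_QiQ L) mul1mx.
  by rewrite adjE -scalemxAr -!scalemxAl.
by rewrite addrAC [Y - _]addrC addrK.
Qed.

End Lifted.
End Systems.

(** * Necessity *)

Section Scalars.
Variable R : realType.
Implicit Types (phi psi : Cc R) (x y : mplus R).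

Lemma scal_subproof (c : R) : c *: @dirac0 R \in @mplus_pred R.
Proof.
rewrite inE; apply/MplusP; split.
  rewrite -[_ *: _]addr0; apply: order_zeroZD; [exact: dirac0_order_zero|].
  exact: (mplus_oz 0).
by exists 0 => phi h; rewrite -[LHS]/(c * phi 0) h ?mulr0//= in_itv/= lexx.
Qed.

(** A real number as a multiple of the Dirac mass, so that real scalings can enter matrix identities
    over [mplus]. *)
Definition scal c : mplus R := MkMplus (scal_subproof c).

Lemma mval_scal c x phi : mval (scal c * x) phi = c * mval x phi.
Proof.
have [a ca] := mplus_conc x; have [b cb] := mplus_conc (scal c).
have c0 : conc (scal c) `[0, +oo[.
  by move=> psi h; rewrite -[LHS]/(c * psi 0) h ?mulr0//= in_itv/= lexx.
rewrite mvalM (conv_cut _ (mplus_oz _) c0 (mplus_oz x) ca).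
rewrite -[LHS]/(c * cc_fun _ 0) cutE; last exact: (inner_rbounded _ (mplus_oz x) ca).
by rewrite cutoff1// mul1r; congr (_ * mval x _); apply: cc_ext => t /=; rewrite add0r.
Qed.

Lemma conc_scal c x (F : set R) : conc x F -> conc (scal c * x) F.
Proof. by move=> cx phi hphi; rewrite mval_scal cx// mulr0. Qed.

Lemma cvg_finite_sum (F : set_system nat) (FF : Filter F) (I : Type) (r : seq I)
    (u : I -> nat -> R) (v : I -> R) :
  (forall i, u i n @[n --> F] --> v i) ->
  \sum_(i <- r) u i n @[n --> F] --> \sum_(i <- r) v i.
Proof.
move=> h; elim: r => [|i r IH].
  rewrite big_nil (_ : (fun n => _) = fun=> 0); first exact: cvg_cst.
  by apply/funext => n; rewrite big_nil.
rewrite big_cons (_ : (fun n => _) = fun n => u i n + \sum_(i <- r) u i n).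
  exact: cvgD.
by apply/funext => n; rewrite big_cons.
Qed.

(** The common left bound [b] lets a single cut of the inner function serve all [n], so the product
    is the original weak convergence at one test function. The filter is arbitrary because it will
    be an ultrafilter. *)
Lemma mul_cvg (F : set_system nat) (FF : Filter F) (a_ : nat -> mplus R)
    (a c : mplus R) (b : R) :
  (forall n, conc (a_ n) `[b, +oo[) -> conc a `[b, +oo[ ->
  (forall psi, mval (a_ n) psi @[n --> F] --> mval a psi) ->
  forall phi, mval (a_ n * c) phi @[n --> F] --> mval (a * c) phi.
Proof.
move=> cn ca lim phi; have [b' cc] := mplus_conc c.
rewrite mvalM (conv_cut _ (mplus_oz _) ca (mplus_oz _) cc).
rewrite (_ : (fun n => _) =
  fun n => mval (a_ n) (cut b (fun s => mval c (translate s phi)))); last first.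
  by apply/funext => n; rewrite mvalM (conv_cut _ (mplus_oz _) (cn n) (mplus_oz _) cc).
exact: lim.
Qed.

End Scalars.

(** * Solvable data and their weak closedness *)

Section Reachability.
Variables (R : realType) (d m : nat) (Sigma : pseudo_rational R d m).
Variables (Q Qi : 'M[mplus R]_d) (P : 'M[mplus R]_(d, m)).
Hypothesis L : lifted Sigma Q Qi P.
Variables (T : R) (j : 'I_d).
Implicit Types (phi psi : Cc R) (w : mplus R) (U : 'cV[mplus R]_m).

(** The subtracted column is Q^-1 applied to w e_j. *)
Definition solves U w := negmx (Qi *m P *m U - \col_i (Qi i j * w)).

(** The second clause bounds the total variation of each component of the input by [k]. *)
Definition solvable (k : R) w := exists U, [/\
  forall l, conc (U l 0) (`[- T, 0]%classic : set R),
  forall l phi B, (forall x, `|phi x| <= B) -> `|mval (U l 0) phi| <= k * B &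
  solves U w].

Lemma solvable_le k k' w : k <= k' -> solvable k w -> solvable k' w.
Proof.
move=> kk [U [h1 h2 h3]]; exists U; split=> // l phi B hB.
apply: le_trans (h2 l phi B hB) _; apply: ler_wpM2r => //.
exact: le_trans (normr_ge0 _) (hB 0).
Qed.

(** Used contrapositively: a peak too expensive for level (k + k') / c remains too expensive for
    level [k] after being scaled by [c] and added to a datum solvable at level [k']. *)
Lemma solvable_comb k k' w w' c : 0 < c -> solvable k w -> solvable k' w' ->
  solvable ((k + k') / c) (scal c^-1 * (w - w')).
Proof.
move=> c0 [U [h1 h2 h3]] [U' [h1' h2' h3']].
exists (scal c^-1 *: (U - U')); split=> [l|l phi B hB|].
- rewrite !mxE; apply: conc_scal => phi hphi.
  by rewrite mvalB -[LHS]/(mval (U l 0) phi - mval (U' l 0) phi) h1// h1'// subrr.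
- rewrite !mxE mval_scal normrM gtr0_norm ?invr_gt0// mulrAC mulrC ler_pM2r ?invr_gt0//.
  rewrite mulrDl mvalB -[X in `|X|]/(mval (U l 0) phi - mval (U' l 0) phi).
  by apply: le_trans (ler_normB _ _) _; apply: lerD; [exact: h2|exact: h2'].
- rewrite /solves.
  have -> : Qi *m P *m (scal c^-1 *: (U - U')) - \col_i (Qi i j * (scal c^-1 * (w - w'))) =
    scal c^-1 *: ((Qi *m P *m U - \col_i (Qi i j * w)) -
                  (Qi *m P *m U' - \col_i (Qi i j * w'))).
    rewrite -scalemxAr mulmxBr.
    have -> : \col_i (Qi i j * (scal c^-1 * (w - w'))) =
      scal c^-1 *: (\col_i (Qi i j * w) - \col_i (Qi i j * w')).
      by apply/matrixP => i i'; rewrite !mxE -mulrBr mulrCA.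
    rewrite -scalerBr; congr (_ *: _).
    by rewrite !opprB addrACA [RHS]addrACA; congr (_ + _); exact: addrC.
  by move=> i i'; rewrite mxE; apply: conc_scal; apply: (negmxB h3 h3').
Qed.

(** Weak compactness of bounded measures through an ultrafilter: all pairings with test functions
    converge along it at once, with no subsequence to extract. The variation bound and the support
    in [-T, 0] survive the limit, and the common left end [- T] lets the equation pass to it. *)
Lemma solvable_closed k (w_ : nat -> mplus R) w b :
  (forall n, conc (w_ n) `[b, +oo[) -> conc w `[b, +oo[ ->
  (forall psi, mval (w_ n) psi @[n --> \oo] --> mval w psi) ->
  (forall n, solvable k (w_ n)) -> solvable k w.
Proof.
move=> cn cw lim hs; have [U_ hU] := choice hs.
have [G [UG hG]] := ultraFilterLemma eventually_filter.
have limG psi : mval (w_ n) psi @[n --> G] --> mval w psi.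
  by move=> V /lim/hG.
have PG : ProperFilter G by exact: ultra_proper.
have exv l psi : exists v : R, mval (U_ n l 0) psi @[n --> G] --> v.
  have [B B0 HB] := cc_bounded psi.
  pose F : set_system R := fmap (fun n => mval (U_ n l 0) psi : R) G.
  have FF : ProperFilter F by exact: fmap_proper_filter.
  have FB : G [set n | `|mval (U_ n l 0) psi| <= k * B].
    by apply: filterE => n; have [_ h _] := hU n; exact: h.
  (* Compactness gives a cluster point, and along an ultrafilter a cluster point is a limit. *)
  have [v [_ hv]] := @ball_itv_compact R (k * B) F FF FB.
  exists v => V Vv; have [//|GV] := in_ultra_setVsetC ((fun n => mval (U_ n l 0) psi : R) @^-1` V) UG.
  by have [t [nVt Vt]] := hv (~` V) V GV Vv.
pose V l psi := sval (cid (exv l psi)) : R^o.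
have hV l psi : mval (U_ n l 0) psi @[n --> G] --> (V l psi : R).
  exact: (svalP (cid (exv l psi))).
have Vbound l psi B : (forall x, `|psi x| <= B) -> `|V l psi| <= k * B.
  move=> hB; apply: (closed_cvg (fun v : R => `|v| <= k * B) _ _ _ (hV l psi)).
    by apply: compact_closed (@ball_itv_compact R (k * B)); exact: norm_hausdorff.
  by apply: nearW => n; have [_ h _] := hU n; exact: h.
have Vconc l : conc (V l) (`[- T, 0]%classic : set R).
  move=> phi hphi; apply: (cvg_unique _ (hV l phi)); first exact: norm_hausdorff.
  rewrite (_ : (fun n => _) = fun=> 0); first exact: cvg_cst.
  by apply/funext => n; have [h _ _] := hU n; exact: h.
have Voz l : order_zero (V l).
  apply: order_zeroP => [c phi psi|M M0]; last by exists k => phi B _; exact: Vbound.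
  apply: (cvg_unique _ (hV l (c *: phi + psi))); first exact: norm_hausdorff.
  rewrite (_ : (fun n => _) = fun n => c * mval (U_ n l 0) phi + mval (U_ n l 0) psi).
    by apply: cvgD; [apply: cvgM; [exact: cvg_cst|exact: hV]|exact: hV].
  by apply/funext => n; rewrite (ozP (mplus_oz _)).
have Vge l : conc (V l) `[- T, +oo[.
  by apply: conc_sub (Vconc l) => t /=; rewrite !in_itv/= andbT => /andP[].
have Vmem l : V l \in @mplus_pred R.
  by rewrite inE; apply/MplusP; split => //; exists (- T); exact: Vge.
exists (\col_l MkMplus (Vmem l)); split=> [l|l phi B hB|].
- by rewrite mxE; exact: Vconc.
- by rewrite mxE; exact: Vbound.
move=> i i' phi hphi; rewrite ord1.
pose D (n : nat) := mval ((Qi *m P *m U_ n) i 0) phi - mval (Qi i j * w_ n) phi.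
have subE (X : 'cV[mplus R]_m) v : mval ((Qi *m P *m X - \col_i (Qi i j * v)) i 0) phi =
    mval ((Qi *m P *m X) i 0) phi - mval (Qi i j * v) phi.
  by rewrite mxE [X in _ + X]mxE [X in _ - X]mxE.
have D0 n : D n = 0.
  by have [_ _ /(_ i 0 phi hphi)] := hU n; rewrite subE.
have DlG : D n @[n --> G] --> mval ((Qi *m P *m \col_l MkMplus (Vmem l)) i 0) phi - mval (Qi i j * w) phi.
  apply: cvgB.
    have sumE (X : 'cV[mplus R]_m) : mval ((Qi *m P *m X) i 0) phi =
        \sum_l mval (X l 0 * (Qi *m P) i l) phi.
      rewrite mxE mval_sum; under eq_bigr do rewrite mulrC.
      exact: (big_morph (fun e : Distr R => e phi)).
    rewrite sumE (_ : (fun n => _) = fun n => \sum_l mval (U_ n l 0 * (Qi *m P) i l) phi); last first.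
      by apply/funext => n; exact: sumE.
    apply: cvg_finite_sum => l; apply: (@mul_cvg _ G _ _ _ _ (- T)).
    + move=> n; have [h _ _] := hU n; apply: conc_sub (h l) => t /=.
      by rewrite !in_itv/= andbT => /andP[].
    + by rewrite mxE; exact: Vge.
    + by move=> psi; rewrite mxE; exact: hV.
  rewrite mulrC (_ : (fun n => _) = fun n => mval (w_ n * Qi i j) phi); last first.
    by apply/funext => n; rewrite mulrC.
  exact: (@mul_cvg _ G _ _ _ _ b cn cw limG phi).
rewrite subE.
apply: (cvg_unique _ DlG); first exact: norm_hausdorff.
by rewrite (_ : D = fun=> 0); [exact: cvg_cst|exact/funext].
Qed.

End Reachability.

(** * Integrable inputs as bounded measures, and an approximate identity *)

Section Peaks.
Variable R : realType.
Implicit Types (phi : Cc R) (f u : R -> R).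
Local Notation mu := (@lebesgue_measure R).

(** The constant is the L^1 norm of [u]; unlike a mere order-zero bound, it does not depend on the
    support of the test function. *)
Lemma Omega1_lift u : Omega1 u -> exists x k, [/\ mval x = fdistr u, 0 <= k &
  forall phi B, (forall t, `|phi t| <= B) -> `|fdistr u phi| <= k * B].
Proof.
move=> [i [_ iu u0]]; pose D : set R := `[- i%:R, 0]%classic.
have mD : measurable (D : set (measurableTypeR R)) by exact: measurable_itv.
have u0' t : ~ D t -> u t = 0 by move=> h; apply: u0; apply/negP => h'; exact: h.
have uD : u = u \_ D.
  apply/funext => t; rewrite patchE; case: ifPn => // /negP h.
  by rewrite u0'// => h'; apply: h; rewrite inE.
have lu : locint u.
  move=> M; rewrite uD -restrict_EFin; apply/integrable_restrict; [exact: mD|exact: measurable_ival|].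
  by apply: integrableS iu; [exact: mD|exact: measurableI (measurable_ival M) mD|exact: subIsetr].
have ui t : i%:R < `|t| -> u t = 0.
  move=> it; apply: u0'; rewrite /D /= in_itv/= => /andP[h1 h2].
  by move: it; rewrite ler0_norm//; lra.
have h : fdistr u \in @mplus_pred R.
  rewrite inE; apply/MplusP; split; first exact: fdistr_oz.
  exists (- i%:R); apply: (@conc_sub _ _ D).
    by move=> t; rewrite /D /= !in_itv/= andbT => /andP[].
  exact: fdistr_conc.
exists (MkMplus h), (Rintegral mu (ival i%:R) (fun x => `|u x|)); split=> //.
  by apply: Rintegral_ge0.
move=> phi B hB; have [M M0 HM] := cc_supp phi.
rewrite -(@Rintegral_suppE _ (fun x => `|u x|) (ival (Num.max M i%:R)) i%:R).
- apply: fdistr_bound => // t; rewrite gt_max => /andP[h1 _]; exact: HM.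
- by move=> t /ivalP h1; apply/ivalP; rewrite le_max h1 orbT.
- by move=> t /ui ->; rewrite normr0.
Qed.

(** The peaks sit to the left of 0, so that data built from them are supported in ]-oo, 0]. *)
Definition peak_itv n : set R := `[- n.+1%:R^-1, 0]%classic.
Definition peak n : R -> R := (fun _ : R => n.+1%:R : R) \_ (peak_itv n).

Lemma measurable_peak_itv n : measurable (peak_itv n : set (measurableTypeR R)).
Proof. exact: measurable_itv. Qed.

Lemma peak_locint n : locint (peak n).
Proof.
apply: locint_restrict; first exact: measurable_peak_itv.
by apply: continuous_locint; exact: cst_continuous.
Qed.

Lemma peak_ge0 n t : 0 <= peak n t.
Proof. by rewrite /peak patchE; case: ifP. Qed.

Lemma peakN n t : ~ peak_itv n t -> peak n t = 0.
Proof. by move=> h; rewrite /peak patchE memNset. Qed.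

Lemma peak_itv_norm n t : peak_itv n t -> `|t| <= n.+1%:R^-1.
Proof. by rewrite /peak_itv /= in_itv/= ler_norml => /andP[-> h]; rewrite (le_trans h)// invr_ge0. Qed.

Lemma invn_le1 n : n.+1%:R^-1 <= 1 :> R.
Proof. by rewrite invf_le1// ler1n. Qed.

Lemma peak_integral n M : 1 <= M -> Rintegral mu (ival M) (peak n) = 1.
Proof.
move=> M1; rewrite /peak -Rintegral_mkcondr.
have -> : ival M `&` peak_itv n = peak_itv n.
  apply/seteqP; split=> [t []//|t ht]; split => //; apply/ivalP.
  exact: le_trans (le_trans (peak_itv_norm ht) (invn_le1 n)) M1.
rewrite Rintegral_cst; last exact: measurable_peak_itv.
rewrite -[X in _ * X]/(fine (@lebesgue_measure R (peak_itv n))).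
have n0 : - n.+1%:R^-1 < 0 :> R by rewrite oppr_lt0 invr_gt0.
by rewrite /peak_itv lebesgue_measure_itv/= lte_fin n0 -EFinD sub0r opprK/= divff.
Qed.

Lemma peak_integral_le n M : Rintegral mu (ival M) (fun t => `|peak n t|) <= 1.
Proof.
have M1 : 1 <= Num.max M 1 by rewrite le_max lexx orbT.
rewrite -[X in _ <= X](peak_integral n M1).
apply: le_trans (le_Rintegral_ival (peak_locint n) (_ : M <= Num.max M 1)) _.
  by rewrite le_max lexx.
rewrite le_eqVlt; apply/orP; left; apply/eqP.
by apply: eq_Rintegral => t _; rewrite ger0_norm ?peak_ge0.
Qed.

Lemma peak_conc n : conc (fdistr (peak n)) (`[-1, 0]%classic : set R).
Proof.
apply: fdistr_conc => t ht; apply: peakN => h; apply: ht; move: h.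
rewrite /peak_itv /= !in_itv/= => /andP[h ->]; rewrite andbT (le_trans _ h)//.
by rewrite lerN2 invn_le1.
Qed.

Lemma peak_bound n phi B : (forall t, `|phi t| <= B) -> `|fdistr (peak n) phi| <= B.
Proof.
move=> hB; have [M M0 HM] := cc_supp phi.
apply: le_trans (fdistr_bound (peak_locint n) HM hB) _.
rewrite ler_piMl ?peak_integral_le//.
exact: le_trans (normr_ge0 _) (hB 0).
Qed.

Lemma peak_cvg phi : fdistr (peak n) phi @[n --> \oo] --> (phi 0 : R).
Proof.
apply/cvgrPdist_le => e e0; have [dl d0 Hd] := cc_unif phi e0.
have [M' M'0 HM'] := cc_supp phi; pose M := Num.max M' 1.
have M1 : 1 <= M by rewrite le_max lexx orbT.
have HM t : M < `|t| -> phi t = 0 by rewrite gt_max => /andP[/HM'].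
near=> n.
have nd : n.+1%:R^-1 < dl.
  rewrite invf_plt ?posrE// (lt_le_trans (truncnS_gt _))// ler_nat.
  by near: n; exact: nbhs_infty_ge.
have im : mu.-integrable (ival M) (EFin \o (fun t => phi 0 * peak n t)).
  exact: (locintZ (phi 0) (peak_locint n) M).
have -> : phi 0 = Rintegral mu (ival M) (fun t => phi 0 * peak n t).
  rewrite RintegralZl ?peak_integral ?mulr1//; first exact: measurable_ival.
  exact: peak_locint.
rewrite (fdistrE _ HM) -(RintegralB (measurable_ival M) im); last first.
  by apply: locint_mulcc; exact: peak_locint.
apply: le_trans (le_normr_Rintegral (measurable_ival M) _) _.
  have := integrableB (measurable_ival M) im (locint_mulcc phi M (peak_locint n)).
  by congr (integrable _ _ _).
apply: (@le_trans _ _ (Rintegral mu (ival M) (fun t => e * peak n t))); last first.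
  rewrite RintegralZl ?peak_integral ?mulr1//; first exact: measurable_ival.
  exact: peak_locint.
apply: (le_Rintegral (measurable_ival M)).
- apply: integrable_norm.
  have := integrableB (measurable_ival M) im (locint_mulcc phi M (peak_locint n)).
  by congr (integrable _ _ _).
- exact: (locintZ e (peak_locint n) M).
move=> t _; rewrite mulrC -mulrBr normrM ger0_norm ?peak_ge0// mulrC.
have [/peak_itv_norm tn|/peakN ->] := pselect (peak_itv n t); last by rewrite !mulr0.
rewrite ler_wpM2r ?peak_ge0//; apply: Hd.
by rewrite sub0r normrN (le_lt_trans tn).
Unshelve. all: by end_near. Qed.

End Peaks.

(** * From solvability of every integrable datum to that of delta_0 *)

Section Necessity.
Variables (R : realType) (d m : nat) (Sigma : pseudo_rational R d m).
Variables (Q Qi : 'M[mplus R]_d) (P : 'M[mplus R]_(d, m)).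
Hypothesis L : lifted Sigma Q Qi P.
Variables (T : R) (j : 'I_d).
Hypothesis reach : reachable_in Sigma T.
Implicit Types (phi psi : Cc R) (w : mplus R) (f : R -> R).
Local Notation mu := (@lebesgue_measure R).
Local Notation solvable := (solvable Qi P T j).
Local Notation unit_itv := (`[-1, 0]%classic : set R).

(** The truncation of Q^-1 w e_j is a function by the ideal property, and a state because Q maps it
    to w e_j up to a term supported in ]-oo, 0]. Reachability supplies the input, and the sum of the
    L^1 norms of its components serves as [k]. *)
Lemma solvable_fun f w : locint f -> mval w = fdistr f -> neg w ->
  exists k, solvable k w.
Proof.
move=> lf wf nw.
have fZ i : isfun (Qi i j * w) by apply: isfunM; exists f.
have /choice[z hz] i : exists g, locint g /\ mval (Qi i j * w) = fdistr g.
  by have [g lg gE] := fZ i; exists g.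
have lz i := (hz i).1; have zE i := (hz i).2.
have /choice[Yf hYf] i := ext0_lift (locint_ext0 (lz i)).
pose Y : 'cV[mplus R]_d := \col_i Yf i.
have YE i : mval (Y i 0) = fdistr (ext0 (z i)) by rewrite mxE hYf.
pose Z : 'cV[mplus R]_d := \col_i (Qi i j * w).
have nZY : negmx (Z - Y).
  move=> i i'; rewrite ord1 [in X in neg X]mxE [in X in _ + X]mxE.
  by apply: (ext0_neg (lz i)) => //; rewrite mxE.
have nQZ : negmx (Q *m Z).
  have -> : Q *m Z = \col_i ((i == j)%:R * w).
    apply/matrixP => i i'; rewrite !mxE.
    have := congr1 (fun A : 'M[mplus R]_d => A i j) (lift_QQi L); rewrite !mxE => <-.
    by rewrite mulr_suml; apply: eq_bigr => k _; rewrite !mxE mulrA.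
  move=> i i'; rewrite mxE; case: (i == j); first by rewrite mul1r.
  by rewrite mul0r.
have stz : state_space Sigma z.
  split=> [i|i]; first exact: locint_Gamma1.
  rewrite -(lift_Q L) (convfunE Q YE); apply: conc_trunc.
  have -> : Q *m Y = Q *m Z - Q *m (Z - Y) by rewrite mulmxBr opprB addrC subrK.
  by apply: negmxB => //; apply: negmxM => //; exact: lift_negQ L.
have [u [uO uT uE]] := reach stz.
have /choice[xk hx] l : exists p : mplus R * R, [/\ mval p.1 = fdistr (u l), 0 <= p.2 &
    forall phi B, (forall t, `|phi t| <= B) -> `|fdistr (u l) phi| <= p.2 * B].
  by have [x [k [h1 h2 h3]]] := Omega1_lift (uO l); exists (x, k).
pose U : 'cV[mplus R]_m := \col_l (xk l).1.
have UE l : mval (U l 0) = fdistr (u l) by rewrite mxE; have [] := hx l.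
exists (\sum_l (xk l).2), U; split=> [l|l phi B hB|].
- by apply: conc_dsupp; [exact: mplus_oz|rewrite UE; exact: uT].
- rewrite UE; have [_ _ h3] := hx l; apply: le_trans (h3 phi B hB) _.
  rewrite ler_wpM2r//; first exact: le_trans (normr_ge0 _) (hB 0).
  rewrite (bigD1 l)//= lerDl sumr_ge0// => l' _.
  by have [] := hx l'.
- rewrite /solves; have -> : Qi *m P *m U - \col_i (Qi i j * w) = (Qi *m P *m U - Y) - (Z - Y).
    by rewrite opprB addrA subrK.
  apply: negmxB => // i i'; rewrite ord1 mxE [in X in _ + X]mxE.
  apply/trunc_eq; have := uE i.
  by rewrite (impulse_lift L) (convfunE _ UE) -YE.
Qed.

Lemma nonpos_unit_itv (al : Distr R) : conc al unit_itv -> conc al (`]-oo, 0]%classic : set R).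
Proof. by apply: conc_sub => t /=; rewrite !in_itv/= => /andP[]. Qed.

Lemma ge_unit_itv (al : Distr R) : conc al unit_itv -> conc al `[-1, +oo[.
Proof. by apply: conc_sub => t /=; rewrite !in_itv/= andbT => /andP[]. Qed.

(** Distance at most [r] from [f] in total variation; this is the norm in which unsolvability at a
    given level is an open condition. *)
Definition near_fun (r : R) (v : mplus R) f := forall phi B,
  (forall t, `|phi t| <= B) -> `|mval v phi - fdistr f phi| <= r * B.

Lemma unit_lift f : locint f -> conc (fdistr f) unit_itv -> exists x, mval x = fdistr f.
Proof.
move=> lf cf; have h : fdistr f \in @mplus_pred R.
  rewrite inE; apply/MplusP; split; first exact: fdistr_oz.
  by exists (-1); exact: ge_unit_itv.
by exists (MkMplus h).
Qed.

Lemma cvg_of_near_fun (r : nat -> R) (v : nat -> mplus R) w f :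
  mval w = fdistr f -> (forall n, near_fun (r n) (v n) f) -> r n @[n --> \oo] --> 0 ->
  forall phi, mval (v n) phi @[n --> \oo] --> mval w phi.
Proof.
move=> wf hn r0 phi; have [B B0 HB] := cc_bounded phi; rewrite wf.
apply/subr_cvg0.
apply: (@squeeze_cvgr _ _ _ _ (fun n => - (r n * B)) (fun n => r n * B)).
- by apply: nearW => n; rewrite -ler_norml; exact: hn.
- by rewrite -oppr0 -(mul0r B); apply: cvgN; apply: cvgM => //; exact: cvg_cst.
- by rewrite -(mul0r B); apply: cvgM => //; exact: cvg_cst.
Qed.

(** * The gliding hump, assuming that delta_0 is solvable at no level *)

Section GlidingHump.
Hypothesis unsolvable1 : forall k, ~ solvable k 1.

(** Otherwise all peaks would be solvable at level [k], hence also their weak limit delta_0. *)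
Lemma unsolvable_peak (k : R) : exists n, forall w, mval w = fdistr (@peak R n) -> ~ solvable k w.
Proof.
apply: contrapT => h.
have /choice[v hv] n : exists w, mval w = fdistr (@peak R n) /\ solvable k w.
  apply: contrapT => h'; apply: h; exists n => w wE ws; apply: h'.
  by exists w.
apply: (unsolvable1 (k := k)); apply: (@solvable_closed _ _ _ Qi P T j k v 1 (-1)).
- by move=> n; rewrite (hv n).1; apply: ge_unit_itv; exact: peak_conc.
- by apply: dirac0_conc; rewrite /= in_itv/= andbT lerN10.
- move=> psi; rewrite (_ : (fun n => _) = fun n => fdistr (@peak R n) psi).
    exact: peak_cvg.
  by apply/funext => n; rewrite (hv n).1.
- by move=> n; have [] := hv n.
Qed.

(** A perturbation of [f] by a small multiple of a sufficiently expensive peak is unsolvable at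
    level [k], since [f] itself is solvable at some level; weak closedness then excludes a whole
    ball around it. *)
Lemma hump_step (k : R) f r : locint f -> conc (fdistr f) unit_itv -> 0 < r ->
  exists (c : R) n r', [/\ 0 <= c, c <= r / 2, 0 < r', r' <= r / 2 &
    forall v : mplus R, conc v unit_itv -> near_fun r' v (fun x => f x + c * @peak R n x) ->
      ~ solvable k v].
Proof.
move=> lf cf r0; have [w wf] := unit_lift lf cf.
have [kf skf] : exists kf, solvable kf w.
  by apply: (solvable_fun lf wf); rewrite /neg wf; exact: nonpos_unit_itv.
pose c := r / 2; have c0 : 0 < c by rewrite divr_gt0.
have [n hn] := unsolvable_peak ((k + kf) / c).
have [p pE] := unit_lift (peak_locint n) (@peak_conc R n).
pose f' x := f x + c * @peak R n x.
have lf' : locint f' by apply: locintD => //; apply: locintZ; exact: peak_locint.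
pose w' := w + scal c * p.
have w'E : mval w' = fdistr f'.
  rewrite fdistrD//; last by apply: locintZ; exact: peak_locint.
  rewrite fdistrZ; last exact: peak_locint.
  by rewrite mvalD wf -pE; congr (_ + _); apply/funext => phi; rewrite mval_scal.
have nsw' : ~ solvable k w'.
  move=> sw'; have := solvable_comb c0 sw' skf; apply: hn.
  rewrite -pE; apply/funext => phi.
  by rewrite /w' addrC addKr mval_scal mval_scal mulrA mulVf ?mul1r// gt_eqF.
have cw' : conc w' `[-1, +oo[.
  rewrite mvalD -[mval w]scale1r; apply: concZD.
    by rewrite wf; exact: ge_unit_itv.
  by apply: conc_scal; rewrite pE; apply: ge_unit_itv; exact: peak_conc.
(* The first term makes a sequence of solvable counterexamples converge weakly to [w']; the second
   keeps the new radius at most half the old one. *)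
pose rr (q : nat) := Num.min (q.+1%:R^-1) (r / 2).
have rr0 q : 0 < rr q by rewrite lt_min invr_gt0 ltr0Sn/= divr_gt0.
suff [q hq] : exists q, forall v : mplus R, conc v unit_itv -> near_fun (rr q) v f' -> ~ solvable k v.
  by exists c, n, (rr q); split => //; [exact: ltW|rewrite ge_min lexx orbT].
apply: contrapT => h.
have /choice[v hv] q : exists v : mplus R, [/\ conc v unit_itv, near_fun (rr q) v f' & solvable k v].
  apply: contrapT => h'; apply: h; exists q => v h1 h2 h3; apply: h'.
  by exists v.
apply: nsw'; apply: (@solvable_closed _ _ _ Qi P T j k v w' (-1)) => //.
- by move=> q; have [h1 _ _] := hv q; exact: ge_unit_itv.
- apply: (cvg_of_near_fun w'E (r := fun q => q.+1%:R^-1)).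
    move=> q phi B hB; have [_ h2 _] := hv q; apply: le_trans (h2 phi B hB) _.
    rewrite ler_wpM2r//; first exact: le_trans (normr_ge0 _) (hB 0).
    by rewrite ge_min lexx.
  exact: cvg_harmonic.
- by move=> q; have [] := hv q.
Qed.

(** A Baire argument made explicit with nested balls: stage [k] excludes solvability at level [k] in
    a ball, and the later humps are too small to leave it. The sum of all humps is an integrable
    datum in every ball, hence solvable at no level, against reachability. *)
Lemma gliding_hump : False.
Proof.
pose st := ((R -> R) * R)%type.
pose good (p : st) := [/\ locint p.1, conc (fdistr p.1) unit_itv & 0 < p.2].
pose next (p : st) (t : R * nat * R) : st := (fun x => p.1 x + t.1.1 * peak t.1.2 x, t.2).
pose stepP (a : nat * st) (t : R * nat * R) :=
  [/\ 0 <= t.1.1, t.1.1 <= a.2.2 / 2, 0 < t.2, t.2 <= a.2.2 / 2 &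
    forall v : mplus R, conc v unit_itv -> near_fun t.2 v (next a.2 t).1 -> ~ solvable a.1%:R v].
(* The step function is made total; on pairs that are not [good] the triple is a dummy. *)
have /choice[F hF] (a : nat * st) : exists t, good a.2 -> stepP a t.
  have [g|ng] := pselect (good a.2); last by exists (0 : R, 0%N, 0 : R).
  have [lf cf r0] := g; have [c [n [r' h]]] := hump_step a.1%:R lf cf r0.
  by exists (c, n, r').
pose s := fix s k : st := if k is k'.+1 then next (s k') (F (k', s k')) else (fun=> 0, 1).
pose t k := F (k, s k).
have sS k : s k.+1 = next (s k) (t k) by [].
have sg k : good (s k).
  elim: k => [|k IH].
    by split=> //; [exact: locint0|apply: fdistr_conc].
  have [_ _ t0 _ _] := hF (k, s k) IH; have [lf cf r0] := IH.
  have lp : locint (fun x => (t k).1.1 * peak (t k).1.2 x) by apply: locintZ; exact: peak_locint.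
  rewrite sS; split=> //; first exact: locintD.
  rewrite fdistrD// fdistrZ; last exact: peak_locint.
  by rewrite addrC; apply: concZD; [exact: peak_conc|exact: cf].
have tP k : stepP (k, s k) (t k) := hF (k, s k) (sg k).
pose c k := (t k).1.1; pose r k := (s k).2.
pose g k x := c k * peak (t k).1.2 x.
have c0 k : 0 <= c k by have [] := tP k.
have cr k : c k <= r k / 2 by have [] := tP k.
have rS k : r k.+1 <= r k / 2 by have [] := tP k.
have r2 k : r k <= 2^-1 ^+ k.
  elim: k => [|k IH]; first by rewrite expr0.
  by apply: le_trans (rS k) _; rewrite exprSr ler_pM2r ?invr_gt0.
have r0 k : 0 < r k by have [] := sg k.
have lg k : locint (g k) by apply: locintZ; exact: peak_locint.
have sE n x : (s n).1 x = \sum_(k < n) g k x.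
  elim: n => [|n IH]; first by rewrite big_ord0.
  by rewrite big_ord_recr /= -IH.
have [M|f lf lim] := @fdistr_series _ g lg.
  apply: (@geometric_partial_sum _ (fun k => Rintegral mu (ival M) (fun x => `|g k x|)) 1 0) => //.
    by move=> k; exact: Rintegral_ge0.
  move=> k _; rewrite mul1r.
  have -> : Rintegral mu (ival M) (fun x => `|g k x|) =
      c k * Rintegral mu (ival M) (fun x => `|peak (t k).1.2 x|).
    rewrite -RintegralZl; [|exact: measurable_ival|by apply: locint_norm; exact: peak_locint].
    by apply: eq_Rintegral => x _; rewrite normrM (ger0_norm (c0 k)).
  apply: le_trans (ler_piMr (c0 k) (peak_integral_le _ _)) _.
  by have := cr k; have := r0 k; have := r2 k; lra.
have sfun n : (s n).1 = fun x => \sum_(k < n) g k x by apply/funext => x; exact: sE.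
have lim' phi : fdistr (s n).1 phi @[n --> \oo] --> (fdistr f phi : R).
  rewrite (_ : (fun n => _) = fun n => fdistr (fun x => \sum_(k < n) g k x) phi); first exact: lim.
  by apply/funext => n; rewrite sfun.
have cf : conc (fdistr f) unit_itv.
  move=> phi hphi; apply: (cvg_unique _ (lim' phi)); first exact: norm_hausdorff.
  rewrite (_ : (fun n => _) = fun=> 0); first exact: cvg_cst.
  by apply/funext => n; have [_ h _] := sg n; exact: h.
have [w wf] := unit_lift lf cf.
(* Each hump fits into the loss of radius: c_k <= r_k / 2 <= r_k - r_{k+1}, and these differences
   telescope. *)
have dist n p phi B : (forall t, `|phi t| <= B) ->
    `|fdistr (s (n + p)%N).1 phi - fdistr (s n).1 phi| <= (r n - r (n + p)%N) * B.
  move=> hB; have B0 : 0 <= B := le_trans (normr_ge0 _) (hB 0).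
  elim: p => [|p IH]; first by rewrite addn0 !subrr normr0 mul0r.
  rewrite addnS sS fdistrD; [|by have [] := sg (n + p)%N|exact: lg].
  rewrite -[(fdistr (s (n + p)%N).1 + _) phi]/(fdistr (s (n + p)%N).1 phi + fdistr (g (n + p)%N) phi).
  rewrite addrAC; apply: le_trans (ler_normD _ _) _.
  have gB : `|fdistr (g (n + p)%N) phi| <= c (n + p)%N * B.
    rewrite fdistrZ; last exact: peak_locint.
    rewrite -[X in `|X|]/(c (n + p)%N * fdistr (peak (t (n + p)%N).1.2) phi).
    by rewrite normrM ger0_norm// ler_wpM2l//; exact: peak_bound.
  apply: le_trans (lerD IH gB) _; rewrite -mulrDl ler_wpM2r//.
  by have := cr (n + p)%N; have := rS (n + p)%N; lra.
have near n : near_fun (r n) w (s n).1.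
  move=> phi B hB; have B0 : 0 <= B := le_trans (normr_ge0 _) (hB 0).
  rewrite wf.
  have limD : `|fdistr (s k).1 phi - fdistr (s n).1 phi| @[k --> \oo] --> `|fdistr f phi - fdistr (s n).1 phi|.
    by apply: cvg_norm; apply: cvgB; [exact: lim'|exact: cvg_cst].
  apply: (@closed_cvg _ _ _ _ _ (fun v : R => v <= r n * B) _ _ _ limD); first exact: closed_le.
  exists n => // k /= nk; rewrite -(subnKC nk); apply: le_trans (dist n (k - n)%N phi B hB) _.
  by rewrite ler_wpM2r// gerBl ltW.
have [k sk] : exists k, solvable k w.
  by apply: (solvable_fun lf wf); rewrite /neg wf; exact: nonpos_unit_itv.
(* This level exceeds [k]; the ball it excludes is centred at the next partial sum, hence the index
   one larger in [near]. *)
have [_ _ _ _ h] := tP (Num.trunc k).+1.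
apply: (h w).
- by rewrite wf.
- exact: (near (Num.trunc k).+2).
- by apply: solvable_le sk; apply: ltW; exact: truncnS_gt.
Qed.

End GlidingHump.

Lemma solvable_one : exists k, solvable k 1.
Proof.
apply: contrapT => h; apply: gliding_hump => k sk.
by apply: h; exists k.
Qed.

End Necessity.

Lemma reachable_coprime (R : realType) (d m : nat) (Sigma : pseudo_rational R d m) (T : R) :
  reachable_in Sigma T -> left_coprime Sigma.
Proof.
move=> reach; have [Q [Qi [P L]]] := lifted_exists Sigma.
have /choice[U hU] j : exists U : 'cV[mplus R]_m,
    (forall l, conc (U l 0) (`[- T, 0]%classic : set R)) /\ solves Qi P j U 1.
  by have [k [U [h1 _ h3]]] := solvable_one L j reach; exists U.
pose S : 'M[mplus R]_(m, d) := \matrix_(l, j) U j l 0.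
pose A := Qi *m (1%:M - P *m S).
have nS : negmx S.
  move=> l j; rewrite mxE; apply: conc_sub ((hU j).1 l) => t /=.
  by rewrite !in_itv/= => /andP[].
have nA : negmx A.
  move=> i j; have -> : A i j = - (Qi *m P *m U j - \col_i (Qi i j * 1)) i 0.
    have E1 : A i j = Qi i j - (Qi *m P *m S) i j.
      by rewrite /A mulmxBr mulmx1 mulmxA [LHS]mxE [X in _ + X]mxE.
    have E2 : (Qi *m P *m S) i j = (Qi *m P *m U j) i 0.
      by rewrite [LHS]mxE [RHS]mxE; apply: eq_bigr => l _; rewrite [S l j]mxE.
    by rewrite E1 E2 [in RHS]mxE [X in _ = - (_ + X)]mxE [X in _ = - (_ - X)]mxE mulr1 opprB.
  by apply: negN; exact: (hU j).2.
exists (matval A), (matval S); split.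
- by move=> i j; rewrite mxE; exact: neg_Mminus.
- by move=> i j; rewrite mxE; exact: neg_Mminus.
- rewrite -(lift_Q L) -(lift_P L) -!matvalM -matvalD -matval1; congr (matval _).
  by rewrite /A mulmxA (lift_QQi L) mul1mx subrK.
Qed.

Theorem theorem5p4 (R : realType) (d m : nat) (hd : (0 < d)%N) (hm : (0 < m)%N)
    (Sigma : pseudo_rational R d m) (T : R)
    (hT : (- linf (convdet (psQ Sigma)) < T%:E)%E) :
  reachable_in Sigma T <-> left_coprime Sigma.
Proof.
split; first exact: reachable_coprime.
have [Q [Qi [P L]]] := lifted_exists Sigma.
exact: (coprime_reachable L hT).
Qed.
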